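(* Let $p>1$, $\alpha_0\ge 0$, $\alpha_1\ge 0$, $\theta\ge 0$ be real numbers with $\alpha_1-p+1>0$, $\alpha_0\ge \alpha_1-p$ and $\theta>\alpha_1-p$, and put $p^*=\frac{(\theta+1)p}{\alpha_1-p+1}$. Let $\varphi:[0,1)\to\mathbb{R}$ be a continuous function such that: (1) $\varphi(0)=0$ and $\varphi(r)>0$ for all $r\in(0,1)$; (2) there exist $c>0$ and $\sigma>1$ such that $\varphi(r)\,|\ln r|^{\sigma}\,\ln|\ln r|\le c$ for all $r>0$ sufficiently close to $0$; (3) $\lim_{r\to1^-}\varphi(r)/|\ln(1-r)|=0$. Then for every $\tau>0$, $$\mathcal{S}_{\theta,\tau}(\varphi)=\sup\Big\{\int_0^1 r^{\theta}|u(r)|^{p^*}\,\big|\ln(\tau+|u(r)|)\big|^{\varphi(r)}\,dr\;:\;u\in X^{1,p}_1(\alpha_0,\alpha_1),\ \|u\|=1\Big\}<\infty .$$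
   Context: For $\gamma\ge0$ and $q\ge1$, $L^q_\gamma=L^q_\gamma(0,1)$ is the Lebesgue space $L^q$ on $(0,1)$ with respect to the measure $r^\gamma dr$. $AC_{loc}(0,1)$ is the set of locally absolutely continuous functions on $(0,1)$. The weighted Sobolev space is $X^{1,p}_1(\alpha_0,\alpha_1)=\mathrm{cl}\{u\in AC_{loc}(0,1): \lim_{r\to1}u(r)=0,\ u\in L^p_{\alpha_0},\ u'\in L^p_{\alpha_1}\}$, the closure being with respect to the norm $(\|u\|^p_{L^p_{\alpha_0}}+\|u'\|^p_{L^p_{\alpha_1}})^{1/p}$. Under the stated assumptions this norm is equivalent to the gradient norm $\|u\|:=\|u'\|_{L^p_{\alpha_1}}=\big(\int_0^1 r^{\alpha_1}|u'|^p\,dr\big)^{1/p}$, and $\|\cdot\|$ always denotes this gradient norm. *)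

(* Defs.v *)
From HB Require Import structures.
From mathcomp Require Import all_boot all_order all_algebra.
From mathcomp Require Import all_classical all_reals all_analysis.

Set Implicit Arguments.
Unset Strict Implicit.
Unset Printing Implicit Defensive.

Import Order.TTheory GRing.Theory Num.Theory.
Import numFieldNormedType.Exports.

Local Open Scope classical_set_scope.
Local Open Scope ring_scope.

(* Functions on (0, 1) or [0, 1) are represented by total functions [R -> R]
   whose values elsewhere are never used. *)

Section WeightedSobolev.
Context {R : realType}.
Implicit Types (u v f phi : R -> R) (p q gamma alpha theta tau : R).

Definition abs_continuous (a b : R) f : Prop :=
  forall e : R, 0 < e -> exists2 d : R, 0 < d &
    forall (n : nat) (x y : 'I_n -> R),
      (forall i, [/\ a <= x i, x i <= y i & y i <= b]) ->
      trivIset [set: 'I_n] (fun i => `]x i, y i[%classic) ->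
      \sum_(i < n) (y i - x i) < d ->
      \sum_(i < n) `|f (y i) - f (x i)| < e.

Definition AC_loc01 f : Prop :=
  forall a b : R, 0 < a -> a < b -> b < 1 -> abs_continuous a b f.

Definition wLnorm q gamma f : \bar R :=
  ((\int[lebesgue_measure]_(r in `]0%R, 1%R[) (r `^ gamma * `|f r| `^ q)%:E)
     `^ q^-1)%E.

Definition wLspace q gamma : set (R -> R) :=
  [set f : R -> R | measurable_fun (`]0%R, 1%R[ : set R) f /\
                    (wLnorm q gamma f < +oo)%E].

(* For a locally absolutely continuous u, u' is the almost everywhere defined
   pointwise derivative; [derive1 u] takes an irrelevant default value on the
   null set where u is not differentiable. *)
Definition wSobolev p alpha0 alpha1 : set (R -> R) :=
  [set u : R -> R | [/\ AC_loc01 u, wLspace p alpha0 u &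
                        wLspace p alpha1 (derive1 u)]].

Definition wSobolev_norm p alpha0 alpha1 u : \bar R :=
  ((wLnorm p alpha0 u `^ p + wLnorm p alpha1 (derive1 u) `^ p) `^ p^-1)%E.

Definition wSobolev_vanish1 p alpha0 alpha1 : set (R -> R) :=
  [set u : R -> R | wSobolev p alpha0 alpha1 u /\
                    u r @[r --> 1^'-] --> (0 : R)].

(* The closure is taken inside [wSobolev]: this space is complete, and an
   almost-everywhere class has at most one locally absolutely continuous
   representative on (0, 1). *)
Definition X1p p alpha0 alpha1 : set (R -> R) :=
  [set u : R -> R | wSobolev p alpha0 alpha1 u /\
    forall e : R, 0 < e -> exists2 v : R -> R,
      wSobolev_vanish1 p alpha0 alpha1 v &
      (wSobolev_norm p alpha0 alpha1 (u \- v)%R < e%:E)%E].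

Definition grad_norm p alpha1 u : \bar R := wLnorm p alpha1 (derive1 u).

Definition crit_exp p alpha1 theta : R :=
  (theta + 1) * p / (alpha1 - p + 1).

Definition supS p alpha0 alpha1 theta tau phi : \bar R :=
  ereal_sup [set (\int[lebesgue_measure]_(r in `]0%R, 1%R[)
      (r `^ theta * `|u r| `^ crit_exp p alpha1 theta *
       `|ln (tau + `|u r|)| `^ phi r)%:E)%E
    | u in [set u : R -> R | X1p p alpha0 alpha1 u /\
                             grad_norm p alpha1 u = 1%E]].

End WeightedSobolev.

(* Main.v *)
(* Write a = alpha1 - p + 1 and q = crit_exp. Hoelder's inequality applied to
   |u(r)| <= \int_r^1 |u'| gives |u(r)| <= C r^(-a/p) and a decay in
   (1 - r)^((p-1)/p) at 1. Since q a / p = theta + 1, the first bound turns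
   r^theta |u|^q = r^theta |u|^(q-p) |u|^p into at most a multiple of
   r^(alpha1-p) |u|^p, whose integral is controlled by the weighted Hardy
   inequality. The logarithmic factor is harmless: near 0 it is bounded, because
   |ln(tau + |u|)| grows at most like |ln r| and phi(r) ln|ln r| is bounded; near
   1 its growth exp(phi(r) ln M) <= (1 - r)^(-eps) is absorbed by the decay of
   |u|^q.
   The inequality |u(r)| <= \int_r^1 |u'| requires that an absolutely continuous
   function be the integral of its pointwise derivative: such a function is a
   difference of two nondecreasing absolutely continuous ones (using its total
   variation), whose Stieltjes measures have Radon-Nikodym densities, and the
   Lebesgue differentiation theorem identifies the density with the
   derivative. *)
Require Import Defs.
From HB Require Import structures.
From mathcomp Require Import all_boot all_order all_algebra.
From mathcomp Require Import all_classical all_reals all_analysis.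
From mathcomp Require Import measurable_realfun ring lra.
Import Order.TTheory GRing.Theory Num.Theory.
Import numFieldNormedType.Exports.
Local Open Scope classical_set_scope.
Local Open Scope ring_scope.

Set Implicit Arguments.
Unset Strict Implicit.
Unset Printing Implicit Defensive.

(** * Absolute continuity over lists of intervals, and its passage to total variation *)

Section AbsolutelyContinuous.
Context {R : realType}.
Implicit Types (a b x y : R) (f : R -> R) (s t : seq (R * R)).

(** A boolean test that the open intervals are disjoint, so that [pairwise] applies to lists;
    neighbouring intervals may share an endpoint. *)
Definition nonoverlap (p q : R * R) : bool :=
  Num.min p.2 q.2 <= Num.max p.1 q.1.

Definition subitv_of a b (p : R * R) : bool := [&& a <= p.1, p.1 <= p.2 & p.2 <= b].

Definition total_length s : R := \sum_(p <- s) (p.2 - p.1).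

Definition total_jump f s : R := \sum_(p <- s) `|f p.2 - f p.1|.

(** Finite families are encoded as lists rather than as functions on ['I_n], which permits
    concatenation of families and induction on them. *)
Definition ac_seq a b f : Prop :=
  forall e : R, 0 < e -> exists2 d : R, 0 < d &
    forall s, all (subitv_of a b) s -> pairwise nonoverlap s ->
      total_length s < d -> total_jump f s < e.

Lemma nonoverlapC p q : nonoverlap p q = nonoverlap q p.
Proof. by rewrite /nonoverlap minC maxC. Qed.

Lemma nonoverlapP (p q : R * R) : nonoverlap p q <->
  `]p.1, p.2[ `&` `]q.1, q.2[ = set0.
Proof.
rewrite /nonoverlap; split => [h|h].
  rewrite -subset0 => z [] /=; rewrite !in_itv/= => /andP[p1 p2] /andP[q1 q2].
  have : Num.max p.1 q.1 < Num.min p.2 q.2.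
    by apply: (@lt_trans _ _ z); rewrite ?gt_max ?lt_min ?p1 ?p2 ?q1 ?q2.
  by rewrite ltNge h.
rewrite leNgt; apply/negP => hlt.
suff : set0 ((Num.max p.1 q.1 + Num.min p.2 q.2) / 2) by [].
rewrite -h; have := midf_lt hlt => -[].
rewrite gt_max lt_min => /andP[h1 h2] /andP[h3 h4].
by split; rewrite /= in_itv/= ?h1 ?h2 ?h3 ?h4.
Qed.

Lemma nonoverlap_sub (p p' q : R * R) : p.1 <= p'.1 -> p'.2 <= p.2 ->
  nonoverlap p q -> nonoverlap p' q.
Proof.
move=> h1 h2; rewrite /nonoverlap => h.
apply: le_trans (le_trans h _).
- by rewrite le_min !ge_min h2 lexx orbT.
- by rewrite ge_max !le_max h1 lexx orbT.
Qed.

Lemma abs_continuous_ac_seq a b f : abs_continuous a b f -> ac_seq a b f.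
Proof.
move=> acf e e0; have [d d0 fd] := acf e e0; exists d => // s sab ps sd.
pose x (i : 'I_(size s)) := (nth (0, 0) s i).1.
pose y (i : 'I_(size s)) := (nth (0, 0) s i).2.
have sumE (F : R * R -> R) :
    \sum_(p <- s) F p = \sum_(i < size s) F (nth (0, 0) s i).
  by rewrite (big_nth (0, 0)) big_mkord.
rewrite /total_jump sumE; apply: (fd _ x y).
- move=> i; have /allP/(_ (nth (0, 0) s i)) := sab.
  by rewrite mem_nth// => /(_ isT)/and3P.
- apply/trivIsetP => i j _ _ ij; apply/nonoverlapP.
  wlog ltij : i j ij / (i < j)%N => [H|].
    have [||/val_inj ijE] := ltngtP (val i) (val j); first exact: H.
      by rewrite nonoverlapC; apply: H; rewrite eq_sym.
    by rewrite ijE eqxx in ij.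
  move/(pairwiseP (0, 0)) : ps => /(_ i j); apply => //; exact: ltn_ord.
- by rewrite -(sumE (fun p => p.2 - p.1)).
Qed.

Lemma ac_seqD a b f g : ac_seq a b f -> ac_seq a b g -> ac_seq a b (f \+ g).
Proof.
move=> acf acg e e0.
have [d1 d10 fd] := acf (e / 2) (divr_gt0 e0 (ltr0Sn _ _)).
have [d2 d20 gd] := acg (e / 2) (divr_gt0 e0 (ltr0Sn _ _)).
exists (Num.min d1 d2) => [|s sab ps]; first by rewrite lt_min d10.
rewrite lt_min => /andP[s1 s2].
have := fd s sab ps s1; have := gd s sab ps s2 => h1 h2.
rewrite (splitr e); apply: le_lt_trans (ltrD h2 h1).
rewrite /total_jump -big_split/=; apply: ler_sum => p _.
by rewrite opprD addrACA ler_normD.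
Qed.

Lemma ac_seqN a b f : ac_seq a b f -> ac_seq a b (\- f).
Proof.
move=> acf e e0; have [d d0 fd] := acf e e0; exists d => // s sab ps sd.
apply: le_lt_trans (fd s sab ps sd); apply: ler_sum => p _.
by rewrite -opprD normrN.
Qed.

Lemma eq_ac_seq a b f g : (forall x, a <= x <= b -> f x = g x) ->
  ac_seq a b f -> ac_seq a b g.
Proof.
move=> fg acf e e0; have [d d0 fd] := acf e e0; exists d => // s sab ps sd.
apply: le_lt_trans (fd s sab ps sd).
rewrite /total_jump big_seq [leRHS]big_seq; apply: ler_sum => p ps'.
have /allP/(_ p ps')/and3P[h1 h2 h3] := sab.
by rewrite !fg// ?h1 ?h2 ?h3 ?(le_trans h1)// (le_trans h2).
Qed.

(** Serves to read a [variation] over a partition as a [total_jump] over a family admissible in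
    [ac_seq]. *)
Lemma partition_pairsP c l : path <%R c l ->
  let P := zip (c :: l) l in
  [/\ all (subitv_of c (last c l)) P, pairwise nonoverlap P &
      total_length P = last c l - c].
Proof.
elim: l c => [|x l IH] c /=.
  by move=> _; rewrite /total_length big_nil subrr.
move=> /andP[cx xl]; have [h1 h2 h3] := IH _ xl.
have xle : x <= last x l.
  elim: l x xl {IH cx h1 h2 h3} => [//|y l IHl] x /= /andP[xy yl].
  by rewrite (le_trans (ltW xy))// IHl.
split.
- apply/andP; split; first by apply/and3P; split => //=; exact: ltW.
  apply: sub_all h1 => q /and3P[q1 q2 q3].
  by apply/and3P; split => //; rewrite (le_trans (ltW cx)).
- rewrite h2 andbT; apply: sub_all h1 => q /and3P[q1 q2 q3].
  by rewrite /nonoverlap/= ge_min le_max q1 orbT.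
- by rewrite /total_length big_cons -/(total_length _) h3/=; ring.
Qed.

(* Each partition of the first interval is moved from the list [s] of total
   variations to the list [t] of plain jumps. *)
Lemma total_variation_ac a b f : ac_seq a b f ->
  forall e : R, 0 < e -> exists2 d : R, 0 < d &
    forall s, all (subitv_of a b) s -> pairwise nonoverlap s ->
      total_length s < d ->
      (\sum_(p <- s) total_variation p.1 p.2 f <= e%:E)%E.
Proof.
move=> acf e e0; have [d d0 fd] := acf e e0; exists d => // s.
suff H : forall s t, all (subitv_of a b) (s ++ t) ->
    pairwise nonoverlap (s ++ t) -> total_length (s ++ t) < d ->
    (\sum_(p <- s) total_variation p.1 p.2 f + (total_jump f t)%:E <= e%:E)%E.
  by have := H s [::]; rewrite cats0 /total_jump big_nil adde0.
elim=> [|p {}s IH] t.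
  by rewrite /= big_nil add0e lee_fin => ? ? ?; apply/ltW/fd.
move=> /= /andP[/and3P[ap p12 pb] stab] /andP[pst pwst].
have -> : total_length (p :: s ++ t) = p.2 - p.1 + total_length (s ++ t).
  by rewrite /total_length big_cons.
move=> lend.
rewrite big_cons -addeA; set S := (\sum_(p <- s) _ + _)%E.
have S0 : (0 <= S)%E.
  rewrite adde_ge0 ?lee_fin ?sumr_ge0//.
  rewrite big_seq; apply: sume_ge0 => q qs; apply: total_variation_ge0.
  have /allP/(_ q) := stab; rewrite mem_cat qs => /(_ isT).
  by rewrite /subitv_of => /and3P[].
have Sfin : S \is a fin_num.
  rewrite ge0_fin_numE// (@le_lt_trans _ _ e%:E) ?ltry//; apply: IH => //.
  apply: le_lt_trans lend; rewrite lerDr subr_ge0//.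
(* Since [S] is finite it can be moved to the right; the supremum defining the first variation is
   then bounded one partition at a time. *)
rewrite -leeBrDr//; apply: ge_ereal_sup => _ [_ [l pl <-] <-].
rewrite leeBrDr// addeC /S -addeA -EFinD.
pose P := zip (p.1 :: l) l.
have tjP : total_jump f (t ++ P) = total_jump f t + variation p.1 p.2 f l.
  rewrite /total_jump big_cat/=; congr (_ + _).
  rewrite variation_zip// /P; elim: l (p.1) {pl P} => [|x l IHl] c.
    by rewrite !big_nil.
  by rewrite /= !big_cons IHl.
rewrite -tjP; case: pl => pl /eqP lastl.
have [P1 P2 P3] := partition_pairsP pl; rewrite -/P lastl in P1 P3.
have {fd IH} := IH (t ++ P); rewrite catA; apply.
- rewrite all_cat stab/=; apply: sub_all P1 => q /and3P[q1 q2 q3].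
  by apply/and3P; split => //; [exact: le_trans q1|exact: le_trans pb].
- rewrite pairwise_cat pwst P2 andbT/= andbT; apply/allrelP => q r qs rP.
  have /allP/(_ r rP)/and3P[r1 _ r2] := P1.
  by rewrite nonoverlapC (nonoverlap_sub r1 r2)//; move/allP : pst; apply.
- rewrite /total_length big_cat/= -!/(total_length _) P3.
  by rewrite addrC.
Qed.

End AbsolutelyContinuous.

(** * Jordan decomposition of an absolutely continuous function *)

Section VariationFunction.
Context {R : realType}.
Variables (a b : R).
Hypothesis ab : a <= b.
Implicit Types (x y : R) (f F : R -> R).

(** Projection onto the interval. Composing with it extends a function from [[a, b]] to the line by
    constants, so that monotonicity holds globally, as a Stieltjes measure requires. *)
Definition clamp x : R := Num.max a (Num.min x b).

Lemma clamp_ge x : a <= clamp x.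
Proof. by rewrite le_max lexx. Qed.

Lemma clamp_le x : clamp x <= b.
Proof. by rewrite ge_max ab ge_min lexx orbT. Qed.

Lemma clamp_id x : a <= x <= b -> clamp x = x.
Proof. by move=> /andP[ax xb]; rewrite /clamp min_l// max_r. Qed.

Lemma clampK x : clamp (clamp x) = clamp x.
Proof. by rewrite clamp_id// clamp_ge clamp_le. Qed.

Lemma clamp_nd x y : x <= y -> clamp x <= clamp y.
Proof.
by move=> xy; rewrite ge_max !le_max lexx/= le_min !ge_min xy lexx !orbT.
Qed.

Lemma clamp_lipschitz x y : x <= y -> clamp y - clamp x <= y - x.
Proof.
move=> xy; rewrite /clamp; case: (leP x b) => ?; case: (leP y b) => ?;
  case: (leP a x) => ?; case: (leP a y) => ?; case: (leP a b) ab => ? // _; lra.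
Qed.

(** If [d] answers the tolerance 1, an interval of length below [d] has variation at most 1;
    finitely many steps of length [d / 2] from [a] reach [x], and variations add up. *)
Lemma ac_total_variation_fin f : ac_seq a b f ->
  forall x, a <= x <= b -> total_variation a x f \is a fin_num.
Proof.
move=> acf; have [d d0 fd] := total_variation_ac acf ltr01.
suff H : forall n x, a <= x <= b -> x <= a + n%:R * (d / 2) ->
    total_variation a x f \is a fin_num.
  move=> x axb; apply: (H (Num.bound ((x - a) / (d / 2)))) => //.
  have d20 : 0 < d / 2 by rewrite divr_gt0.
  have xa0 : 0 <= (x - a) / (d / 2).
    by rewrite divr_ge0 ?(ltW d20)// subr_ge0; case/andP: axb.
  by rewrite -lerBlDl -ler_pdivrMr//; exact/ltW/archi_boundP.
elim=> [|n IH] x /andP[ax xb] xn.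
  by rewrite mul0r addr0 in xn; rewrite (@le_anti _ _ x a) ?ax ?xn// total_variationxx.
have [xn'|xn'] := leP x (a + n%:R * (d / 2)); first by rewrite IH// ax.
set y := a + n%:R * (d / 2) in xn' *.
have ay : a <= y by rewrite lerDl mulr_ge0// divr_ge0// ltW.
have yb : y <= b by rewrite (le_trans (ltW xn')).
rewrite (total_variationD f ay (ltW xn')) fin_numD (IH y) ?ay ?yb//=.
rewrite ge0_fin_numE; last by rewrite total_variation_ge0// ltW.
have := fd [:: (y, x)]; rewrite big_seq1/= => /(_ _ _ _)/le_lt_trans; apply.
- by rewrite /subitv_of/= ay xb (ltW xn').
- by [].
- rewrite /total_length big_seq1/= ltrBlDl (le_lt_trans xn)// /y -addrA ltrD2l.
  by rewrite -natr1 mulrDl mul1r ltrD2l; lra.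
- by rewrite ltry.
Qed.

(** With [V] the variation function, [f = (V + f) - V]. Increments of [V] dominate those of [f] in
    absolute value, which makes [V + f] nondecreasing, and [V] inherits absolute continuity through
    [total_variation_ac]. *)
Lemma ac_difference f : ac_seq a b f -> exists F G : R -> R,
  [/\ nondecreasing_fun F, nondecreasing_fun G, ac_seq a b F, ac_seq a b G &
   [/\ (forall x, F x = F (clamp x)), (forall x, G x = G (clamp x)) &
   (forall x, a <= x <= b -> f x = F x - G x)]].
Proof.
move=> acf; have fin := ac_total_variation_fin acf.
have clamp_in x : a <= clamp x <= b by rewrite clamp_ge clamp_le.
pose V x := fine (total_variation a (clamp x) f).
have VE x y : a <= x -> x <= y -> y <= b ->
    (V y - V x)%:E = total_variation x y f.
  move=> ax xy yb; have xab : a <= x <= b by rewrite ax (le_trans xy).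
  have yab : a <= y <= b by rewrite yb (le_trans ax).
  rewrite /V !clamp_id// EFinB !fineK ?fin//.
  rewrite (total_variationD f ax xy) addeAC subee ?add0e// fin//.
have fV x y : a <= x -> x <= y -> y <= b -> `|f y - f x| <= V y - V x.
  by move=> ax xy yb; rewrite -lee_fin VE// total_variation_ge.
have VC x : V x = V (clamp x) by rewrite /V clampK.
have acV : ac_seq a b V.
  move=> e e0; have [d d0 fd] := total_variation_ac acf (divr_gt0 e0 (ltr0Sn _ 1)).
  exists d => // s sab ps sd.
  apply: (@le_lt_trans _ _ (e / 2)); last by lra.
  rewrite -lee_fin; apply: le_trans (fd s sab ps sd).
  rewrite /total_jump -sumEFin big_seq [leRHS]big_seq; apply: lee_sum => p ps'.
  have /allP/(_ p ps')/and3P[h1 h2 h3] := sab.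
  rewrite -VE// lee_fin ger0_norm//.
  by apply: le_trans (fV _ _ h1 h2 h3).
exists (fun x => V x + f (clamp x)), V; split.
- move=> x y xy; rewrite VC (VC y).
  have := fV _ _ (clamp_ge x) (clamp_nd xy) (clamp_le y).
  by rewrite ler_norml => /andP[? ?]; lra.
- move=> x y xy; rewrite VC (VC y).
  have := fV _ _ (clamp_ge x) (clamp_nd xy) (clamp_le y).
  by move/(le_trans (normr_ge0 _)); lra.
- apply: ac_seqD => //; apply: eq_ac_seq acf => x axb; by rewrite clamp_id.
- exact: acV.
- split => // x; first by rewrite -VC clampK.
  by move=> axb; rewrite clamp_id//; ring.
Qed.

End VariationFunction.

(** * Stieltjes measures of nondecreasing absolutely continuous functions *)

Lemma open_interval_bounded {R : realType} (I : set R) : open I ->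
  is_interval I -> (lebesgue_measure I < +oo)%E ->
  exists p : R * R, p.1 <= p.2 /\ I = `]p.1, p.2[%classic.
Proof.
move=> oI iI; have [->|/set0P I0] := eqVneq I set0.
  by move=> _; exists (0, 0); rewrite set_itvoo0.
have IE := RhullK (mem_set iI); move: oI I0; rewrite -IE.
move: (Rhull I) {IE iI} => [[b1 x|[]] [b2 y|[]]] oI [z zI];
  rewrite ?lebesgue_measure_itv//=; rewrite /= ?in_itv//= in zI;
  rewrite ?ltry ?ltNyr ?ltNyy//= ?itv_boundlr//; last by rewrite andbF in zI.
move=> _; exists (x, y); split.
  by case: b1 b2 zI {oI} => [] [] /= /andP[h1 h2]; lra.
by move/interior_id : oI => <-; rewrite interior_itv_bnd.
Qed.

Section StieltjesDensity.
Context {R : realType}.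
Variables (a b : R) (F : R -> R).
Hypothesis ab : a <= b.
Hypothesis ndF : nondecreasing_fun F.
Hypothesis acF : ac_seq a b F.
Hypothesis Fclamp : forall x, F x = F (clamp a b x).

Let F_rc : right_continuous F.
Proof.
move=> x; apply/cvgrPdist_lt => e e0; have [d d0 Fd] := acF e0.
near=> y; have xy : x <= y by near: y; exact: nbhs_right_ge.
rewrite distrC Fclamp (Fclamp x).
have := Fd [:: (clamp a b x, clamp a b y)]; rewrite /total_jump big_seq1/=.
apply; rewrite ?/total_length ?big_seq1//=.
  by rewrite /subitv_of/= clamp_ge clamp_le// clamp_nd.
apply: le_lt_trans (clamp_lipschitz ab xy) _.
by rewrite ltrBlDl; near: y; apply: nbhs_right_lt; rewrite ltrDl.
Unshelve. all: by end_near. Qed.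

HB.instance Definition _ := isCumulative.Build R _ R F ndF F_rc.

Let mu := @lebesgue_measure R.
Let nu := lebesgue_stieltjes_measure F.

Let nu_itv x y : x <= y -> nu `]x, y]%classic = (F y - F x)%:E.
Proof.
move=> xy; rewrite /nu/= /lebesgue_stieltjes_measure /measure_extension.
rewrite measurable_mu_extE/=; last exact: is_ocitv.
by rewrite wlength_itv_bnd.
Qed.

Let nu_finT : (nu setT < +oo)%E.
Proof.
rewrite -(bigcup_itvT false false).
pose I n : set R := `]- (n%:R), n%:R]%classic.
have : (nu \o I) n @[n --> \oo] --> nu (\bigcup_n I n).
  apply: nondecreasing_cvg_mu; rewrite /I//; first exact: bigcup_measurable.
  by move=> *; apply/subsetPset/set_interval.subset_itv; rewrite leBSide/= ?lerN2 ler_nat.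
move=> /cvg_lim <-//.
apply: (@le_lt_trans _ _ (F b - F a)%:E); last exact: ltry.
apply: lime_le.
  apply: ereal_nondecreasing_is_cvgn => m n mn; apply: le_measure; rewrite ?inE//; last first.
    by apply: set_interval.subset_itv; rewrite leBSide/= ?lerN2 ler_nat.
  - exact: measurable_itv.
  - exact: measurable_itv.
apply: nearW => n /=; rewrite nu_itv ?ge0_cp// lee_fin lerB//.
  by rewrite Fclamp; apply: ndF; exact: clamp_le.
by rewrite (Fclamp (- _)); apply: ndF; exact: clamp_ge.
Qed.


(** Outer regularity encloses a null set in an open set of measure below [d]. Its components are
    disjoint intervals of total length below [d], so every finite sum of their [nu]-masses is
    bounded by a jump sum of [F] smaller than [e]. *)
Let nu_dominated : nu `<< mu.
Proof.
apply/null_content_dominatesP => A mA A0; apply/eqP.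
rewrite -measure_le0; apply/lee_addgt0Pr => e e0; rewrite add0e.
have [d d0 Fd] := acF e0.
have Afin : (mu A < +oo)%E by rewrite [mu A]A0.
have [U [oU AU]] := lebesgue_regularity_outer mA Afin d0.
move=> mUAd; have mU : measurable U by exact: open_measurable.
have mUd : (mu U < d%:E)%E.
  rewrite -(setDUK AU).
  have := measureU2 (mu : {measure set _ -> \bar R}) mA (measurableD mU mA).
  move=> /le_lt_trans; apply; rewrite -/mu.
  by rewrite [X in (X + _)%E]A0 add0e.
pose I := open_disjoint_itv oU.
have mI n : measurable (I n).
  by apply: open_measurable; exact: open_disjoint_itv_open.
have UI : U = \bigcup_n I n by exact: open_disjoint_itv_bigcup.
have tI : trivIset setT I by exact: open_disjoint_itv_trivIset.
have IU n : I n `<=` U by rewrite UI => x Ix; exists n.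
have /choice[p pP] n : exists p : R * R, p.1 <= p.2 /\ I n = `]p.1, p.2[%classic.
  apply: open_interval_bounded; first exact: open_disjoint_itv_open.
    exact: open_disjoint_itv_is_interval.
  apply: le_lt_trans (lt_trans mUd (ltry _)).
  by apply: le_measure; [rewrite inE; exact: mI|rewrite inE; exact: mU|exact: IU].
(* Components may stick out of [[a, b]]. Clamping them leaves the increments of [F] unchanged, keeps
   the intervals nonoverlapping and does not lengthen them. *)
pose q n := (clamp a b (p n).1, clamp a b (p n).2).
apply: (@le_trans _ _ (nu U)).
  by apply: le_measure => //; exact/mem_set.
have bigcupE (m : {measure set (measurableTypeR R) -> \bar R}) :
    (m U = \sum_(k <oo) m (I k))%E.
  by rewrite {1}UI measure_semi_bigcup// -UI.
have -> : nu U = (\sum_(k <oo) nu (I k))%E.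
  exact: (bigcupE (lebesgue_stieltjes_measure F)).
apply: lime_le; first exact: is_cvg_nneseries.
apply: nearW => n; rewrite big_mkord.
have qsub i : subitv_of a b (q i).
  rewrite /subitv_of/= clamp_ge clamp_le// andbT/=.
  by apply: clamp_nd; have [] := pP i.
apply: (@le_trans _ _ (total_jump F [seq q i | i <- index_iota 0 n])%:E).
  rewrite /total_jump big_map big_mkord -sumEFin.
  apply: lee_sum => i _; have [p12 ->] := pP i.
  have -> : F (q i).2 - F (q i).1 = F (p i).2 - F (p i).1.
    by rewrite /= -!Fclamp.
  rewrite ger0_norm; last by rewrite subr_ge0 ndF.
  rewrite -nu_itv//; apply: le_measure; rewrite ?inE//.
  exact: subset_itv_oo_oc.
rewrite lee_fin; apply/ltW/Fd.
- by apply/allP => r /mapP[i _ ->].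
- rewrite pairwise_map; apply: (@sub_pairwise _ ltn); last first.
    by rewrite -(sorted_pairwise ltn_trans) iota_ltn_sorted.
  move=> i j /= ij.
  have /nonoverlapP : `](p i).1, (p i).2[ `&` `](p j).1, (p j).2[ = set0.
    have [_ <-] := pP i; have [_ <-] := pP j.
    by move/trivIsetP : tI; apply => //; rewrite (ltn_eqF ij).
  rewrite /nonoverlap => /(@clamp_nd _ a b) h.
  have cmin x y : Num.min (clamp a b x) (clamp a b y) <= clamp a b (Num.min x y).
    by rewrite ge_min; case: (leP x y) => _; rewrite lexx ?orbT.
  have cmax x y : clamp a b (Num.max x y) <= Num.max (clamp a b x) (clamp a b y).
    by rewrite le_max; case: (leP x y) => _; rewrite lexx ?orbT.
  exact: le_trans (cmin _ _) (le_trans h (cmax _ _)).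
- rewrite -lte_fin; apply: le_lt_trans mUd.
  rewrite /total_length big_map big_mkord -sumEFin.
  apply: (@le_trans _ _ (\sum_(i < n) mu (I i))%E).
    apply: lee_sum => i _; have [p12 ->] := pP i.
    rewrite /mu lebesgue_measure_itv/= lte_fin; case: ltP => p12'.
      by rewrite -EFinD lee_fin clamp_lipschitz.
    by rewrite (@le_anti _ _ (p i).1 (p i).2) ?p12// subrr.
  have -> : mu U = (\sum_(k <oo) mu (I k))%E by exact: (bigcupE lebesgue_measure).
  rewrite -(big_mkord xpredT (mu \o I)).
  exact: (@nneseries_lim_ge _ (mu \o I) xpredT).
Qed.

Lemma ac_nondecreasing_density : exists h : R -> R,
  (@lebesgue_measure R).-integrable setT (EFin \o h) /\
  forall x y, x <= y ->
    ((F y - F x)%:E = \int[lebesgue_measure]_(z in `]x, y]) (h z)%:E)%E.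
Proof.
have fin : fin_num_fun (lebesgue_stieltjes_measure F).
  move=> A mA; rewrite ge0_fin_numE//; apply: le_lt_trans nu_finT.
  by apply: le_measure; rewrite ?inE.
pose nuF := HB.pack_for {finite_measure set (measurableTypeR R) -> \bar R}
  (lebesgue_stieltjes_measure F)
  (Measure_isFinite.Build _ _ _ _ fin).
have [h [h0 hfin inth hE]] :=
  @radon_nikodym_sigma_finite _ _ _ (@lebesgue_measure R) nuF nu_dominated.
exists (fine \o h).
have fh : EFin \o (fine \o h) = h by apply/funext => x /=; rewrite fineK.
rewrite fh; split => // x y xy; rewrite -nu_itv// -[LHS]/(nuF `]x, y]%classic) hE//.
by apply: eq_integral => z _; rewrite /= fineK.
Qed.

End StieltjesDensity.

(** * Fundamental theorem of calculus for absolutely continuous functions *)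

Section FundamentalTheorem.
Context {R : realType}.
Notation mu := (@lebesgue_measure R).
Implicit Types (a b : R) (f : R -> R).

(* The integral of a nonnegative function is by definition a lower integral,
   hence monotone without any measurability assumption. *)
Lemma ge0_le_integral_nonmeasurable (D : set R) (f g : R -> \bar R) :
  (forall x, D x -> 0 <= g x)%E -> (forall x, D x -> g x <= f x)%E ->
  (\int[mu]_(x in D) g x <= \int[mu]_(x in D) f x)%E.
Proof.
move=> g0 gf; rewrite integral_mkcond [X in (_ <= X)%E]integral_mkcond.
rewrite !ge0_integralTE; last 2 first.
- move=> x; rewrite patchE; case: ifPn => // /set_mem Dx.
  exact: le_trans (g0 _ Dx) (gf _ Dx).
- by move=> x; rewrite patchE; case: ifPn => // /set_mem; exact: g0.
apply: ge_ereal_sup => _ [h hg <-]; apply: ereal_sup_ubound; exists h => // x.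
apply: le_trans (hg x) _; rewrite !patchE.
by case: ifPn => // /set_mem; exact: gf.
Qed.

(** Only [g] is assumed measurable, so the null set is removed from the integral of [g] alone; the
    rest is a pointwise comparison, with zero below [f] on the null set. *)
Lemma ge0_ae_le_integral (D : set R) (f g : R -> \bar R) : measurable D ->
  measurable_fun D g -> (forall x, 0 <= f x)%E -> (forall x, 0 <= g x)%E ->
  {ae mu, forall x, D x -> (g x <= f x)%E} ->
  (\int[mu]_(x in D) g x <= \int[mu]_(x in D) f x)%E.
Proof.
move=> mD mg f0 g0 [N [mN N0 NP]].
rewrite (ge0_negligible_integral mN mD mg (fun x _ => g0 x) N0).
rewrite integral_mkcond [X in (_ <= X)%E]integral_mkcond.
apply: ge0_le_integral_nonmeasurable => [x _|x _].
  by rewrite patchE; case: ifP.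
rewrite !patchE; case: ifPn => [/set_mem [Dx Nx]|_]; last by case: ifP.
by rewrite mem_set//; apply: contrapT => H; apply/Nx/NP => /(_ Dx).
Qed.

Lemma ac_density a b f : a <= b -> ac_seq a b f ->
  exists g : R -> R, [/\ mu.-integrable setT (EFin \o g),
   (forall x, a <= x <= b -> f x = f a + \int[mu]_(t in `]a, x]) g t) &
   {ae mu, forall x, `]a, b[%classic x -> derive1 f x = g x}].
Proof.
move=> ab acf.
have [F [G [ndF ndG acF acG [FC GC fFG]]]] :=
  ac_difference ab acf.
have [h [inth hE]] := ac_nondecreasing_density ab ndF acF FC.
have [k [intk kE]] := ac_nondecreasing_density ab ndG acG GC.
pose g := h \- k.
have intg : mu.-integrable setT (EFin \o g).
  exact: (integrableB measurableT inth intk).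
have fE x : a <= x <= b -> f x = f a + \int[mu]_(t in `]a, x]) g t.
  move=> axb; have /andP[ax _] := axb.
  have inth' : mu.-integrable `]a, x] (EFin \o h).
    by apply: (integrableS measurableT) => //.
  have intk' : mu.-integrable `]a, x] (EFin \o k).
    by apply: (integrableS measurableT) => //.
  rewrite RintegralB//.
  have -> : \int[mu]_(t in `]a, x]) h t = F x - F a by rewrite /Rintegral -hE.
  have -> : \int[mu]_(t in `]a, x]) k t = G x - G a by rewrite /Rintegral -kE.
  by rewrite !fFG ?lexx//; ring.
exists g; split => //.
have intgS D : measurable D -> mu.-integrable D (EFin \o g).
  by move=> mD; apply: (integrableS measurableT).
have := @FTC1 _ g (BRight a) (fun y => intgS _ (measurable_itv _))
  (open_integrable_locally openT intg).
apply: filterS; first exact: (ae_filter_ringOfSetsType mu).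
move=> x /= H; rewrite in_itv/= => /andP[ax xb].
have [dG G'] := H ax.
rewrite -G' !derive1E -(_ : 'D_1 (fun x => f a + \int[mu]_(t in `]a, x]) g t) x =
  'D_1 (fun x => \int[mu]_(t in `]a, x]) g t) x); last first.
  rewrite (_ : (fun _ => _) = cst (f a) + (fun x => \int[mu]_(t in `]a, x]) g t))//.
  by rewrite deriveD// derive_cst add0r.
(* The integral representation holds on [[a, b]] only, but an interior point has a neighbourhood
   inside, and derivatives are local. *)
apply: near_eq_derive; near=> y; apply: fE.
have : y \in `]a, b[ by near: y; apply: near_in_itvoo; rewrite in_itv/= ax.
by rewrite in_itv/= => /andP[/ltW -> /ltW ->].
Unshelve. all: by end_near. Qed.

(* The density stands in for the derivative, whose measurability is not known. *)
Lemma ac_le_integral a b f : a <= b -> ac_seq a b f ->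
  exists g : R -> R, [/\ measurable_fun setT g,
   {ae mu, forall x, `]a, b[%classic x -> derive1 f x = g x} &
   (`|f b - f a|%:E <= \int[mu]_(x in `]a, b[) `|g x|%:E)%E].
Proof.
move=> ab acf; have [g [intg fE aeg]] := ac_density ab acf.
have mg : measurable_fun setT g.
  by have /measurable_int/measurable_EFinP := intg.
have intgS D : measurable D -> mu.-integrable D (EFin \o g).
  by move=> mD; apply: (integrableS measurableT).
exists g; split => //.
rewrite (fE b) ?lexx ?ab// addrAC subrr add0r.
rewrite integral_itv_bndo_bndc; last first.
  by apply/measurable_EFinP/measurableT_comp => //; exact: measurable_funS mg.
rewrite -[X in (_ <= X)%E]fineK; last first.
  apply: integrable_fin_num => //; exact: (integrable_abse (intgS _ (measurable_itv _))).
by rewrite lee_fin; apply: le_normr_Rintegral => //; exact: intgS.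
Qed.

Lemma ac_le_integral_derive a b f : a <= b ->
  ac_seq a b f ->
  (`|f b - f a|%:E <= \int[mu]_(x in `]a, b[) `|derive1 f x|%:E)%E.
Proof.
move=> ab acf; have [g [mg aeg le_fg]] := ac_le_integral ab acf.
apply: le_trans le_fg _; apply: ge0_ae_le_integral => //.
- by apply/measurable_EFinP/measurableT_comp => //; exact: measurable_funS mg.
- move: aeg; apply: filterS; first exact: (ae_filter_ringOfSetsType mu).
  by move=> x H Dx; rewrite (H Dx).
Qed.

End FundamentalTheorem.

(** * Integrals of powers over []r, 1[] and []0, s[] *)

Section PowerIntegrals.
Context {R : realType}.
Notation mu := (@lebesgue_measure R).
Implicit Types (b c r s t : R).

Lemma measurable_powR_EFin (D : set R) c : measurable D ->
  measurable_fun D (fun x => (x `^ c)%:E).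
Proof.
move=> mD; apply/measurable_EFinP.
by apply: measurable_funS (measurable_powR c).
Qed.

Lemma integral_powR c r t : 0 < r -> r < t -> c + 1 != 0 ->
  (\int[mu]_(x in `[r, t]) (x `^ c)%:E =
   ((t `^ (c + 1) - r `^ (c + 1)) / (c + 1))%:E)%E.
Proof.
move=> r0 rt c0.
pose F : R -> R := (c + 1)^-1 \*: (@powR R ^~ (c + 1)).
have dF (x : R) : 0 < x -> is_derive x (1 : R) F (x `^ c).
  move=> x0; apply: is_derive_eq.
    exact: is_deriveZ (is_derive1_powR (c + 1) x0).
  by rewrite addrK /GRing.scale/= mulrA mulVf// mul1r.
have cF (x : R) : 0 < x -> F @ x --> F x.
  move=> x0; have [dFx _] := dF _ x0.
  exact/differentiable_continuous/derivable1_diffP.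
rewrite (@continuous_FTC2 _ _ F)//.
- by rewrite /F/= -EFinB -scalerBr /GRing.scale/= mulrC.
- apply: derivable_within_continuous => x; rewrite in_itv/= => /andP[rx _].
  by have [] := is_derive1_powR c (lt_le_trans r0 rx).
- split.
  + move=> x; rewrite in_itv/= => /andP[rx _].
    by have [] := dF _ (lt_trans r0 rx).
  + by apply: cvg_at_right_filter; exact: cF.
  + by apply: cvg_at_left_filter; apply: cF; exact: lt_trans rt.
- move=> x; rewrite in_itv/= => /andP[rx _].
  by rewrite derive1E; have [_ ->] := dF _ (lt_trans r0 rx).
Qed.

Lemma integral_powR_le_tail b r : 1 < b -> 0 < r -> r < 1 ->
  (\int[mu]_(x in `]r, 1%R[) (x `^ (- b))%:E <= (r `^ (1 - b) / (b - 1))%:E)%E.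
Proof.
move=> b1 r0 r1.
apply: (@le_trans _ _ (\int[mu]_(x in `[r, 1%R]) (x `^ (- b))%:E)%E).
  apply: ge0_subset_integral => //=.
  - exact: measurable_powR_EFin.
  - by move=> x _; rewrite lee_fin powR_ge0.
  - exact: subset_itv_oo_cc.
rewrite integral_powR//; last by lra.
rewrite lee_fin powR1 (addrC (- b)) -(opprB b 1) invrN mulrN -mulNr opprB opprB.
by rewrite ler_pM2r ?invr_gt0 ?subr_gt0// gerBl.
Qed.

(** The integrand may be singular at 0, so []0, s[] is exhausted by compact intervals, where the
    antiderivative is available, and monotone convergence passes to the limit. *)
Lemma integral_powR_le_head c s : -1 < c -> 0 < s ->
  (\int[mu]_(x in `]0%R, s[) (x `^ c)%:E <= (s `^ (c + 1) / (c + 1))%:E)%E.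
Proof.
move=> c1 s0; have c10 : 0 < c + 1 by rewrite -ltrBlDr sub0r.
pose F (n : nat) : set R := `[n.+1%:R^-1, s]%classic.
have mF i : measurable (F i) by rewrite /F; exact: measurable_itv.
have nF : nondecreasing_seq F.
  apply/nondecreasing_seqP => n; apply/subsetPset/set_interval.subset_itv => //.
  by rewrite bnd_simp lef_pV2 ?posrE// ler_nat.
have : (\int[mu]_(x in F i) (x `^ c)%:E)%E @[i --> \oo] -->
    (\int[mu]_(x in \bigcup_i F i) (x `^ c)%:E)%E.
  apply: ge0_nondecreasing_set_cvg_integral => //.
  - by move=> i; exact: measurable_powR_EFin.
  - by move=> i x _; rewrite lee_fin powR_ge0.
move=> /cvg_lim H.
apply: (@le_trans _ _ (\int[mu]_(x in \bigcup_i F i) (x `^ c)%:E)%E).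
  apply: ge0_subset_integral => //=.
  - by apply: bigcup_measurable => i _; exact (mF i).
  - by apply: measurable_powR_EFin; apply: bigcup_measurable => i _; exact (mF i).
  - by move=> x _; rewrite lee_fin powR_ge0.
  - move=> x; rewrite /= in_itv/= => /andP[x0 xs].
    have [n _ /= nx] := @near_infty_natSinv_lt R (PosNum x0).
    exists n => //; rewrite /F/= in_itv/= (ltW xs) andbT; apply/ltW.
    exact: (nx n (leqnn n)).
rewrite -H//; apply: lime_le.
  apply: ereal_nondecreasing_is_cvgn.
  apply: ge0_nondecreasing_set_nondecreasing_integral => //.
  - by move=> i; exact: measurable_powR_EFin.
  - by move=> i x _; rewrite lee_fin powR_ge0.
apply: nearW => n; rewrite /F.
(* For small [n] the interval may be empty or a point; the bound then reduces to nonnegativity of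
   the right-hand side. *)
have [ns|sn] := ltP n.+1%:R^-1 s.
  rewrite (integral_powR _ ns) ?invr_gt0 ?(gt_eqF c10)// lee_fin ler_pM2r ?invr_gt0//.
  by rewrite gerBl powR_ge0.
have [->|sn'] := eqVneq n.+1%:R^-1 s.
  by rewrite set_itv1 integral_set1 lee_fin divr_ge0 ?powR_ge0// ltW.
rewrite set_itv_ge ?integral_set0 ?lee_fin ?divr_ge0 ?powR_ge0 ?ltW//.
by rewrite bnd_simp -ltNge lt_neqAle eq_sym sn'.
Qed.

End PowerIntegrals.

(** * Weighted Hoelder and Hardy inequalities *)

Section WeightedHardy.
Context {R : realType}.
Notation mu := (@lebesgue_measure R).
Implicit Types (p m r t x : R) (g u : R -> R).

Definition weighted_pow m p g : R -> R := fun s => s `^ m * `|g s| `^ p.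

Lemma measurable_weighted_pow m p g (D : set R) : measurable D ->
  measurable_fun D g -> measurable_fun D (weighted_pow m p g).
Proof.
move=> mD mg; apply: measurable_funM.
  by apply: measurable_funS (measurable_powR m).
apply: (measurableT_comp (measurable_powR p)).
exact: measurableT_comp.
Qed.

Lemma weighted_pow_ge0 m p g s : 0 <= weighted_pow m p g s.
Proof. by rewrite mulr_ge0 ?powR_ge0. Qed.

(** Hoelder's inequality for the splitting of [|g s|] into [s ^ (m / p) |g s|] and [s ^ (- m / p)]:
    the conjugate exponent [p / (p - 1)] turns the second factor into the weight integrated in the
    hypothesis on [B]. The number [x] is abstract so that it can be a value or an increment of a
    function. *)
Lemma weighted_hoelder p m B r t x g : 1 < p -> 0 <= r ->
  measurable_fun `]r, t[ g ->
  (`|x|%:E <= \int[mu]_(s in `]r, t[) `|g s|%:E)%E ->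
  (\int[mu]_(s in `]r, t[) (s `^ (- (m / (p - 1))))%:E <= B%:E)%E ->
  ((`|x| `^ p)%:E <=
    (B `^ (p - 1))%:E * \int[mu]_(s in `]r, t[) (weighted_pow m p g s)%:E)%E.
Proof.
move=> p1 r0 mg xg intB; set D : set R := `]r, t[%classic.
have mD : measurable D by exact: measurable_itv.
have D0 s : D s -> 0 < s.
  by rewrite /D/= in_itv/= => /andP[rs _]; exact: le_lt_trans rs.
have p0 : 0 < p by lra.
have pN0 : p != 0 by rewrite gt_eqF.
have p10 : 0 < p - 1 by lra.
have p1N0 : p - 1 != 0 by rewrite gt_eqF.
have B0 : 0 <= B.
  rewrite -lee_fin; apply: le_trans intB; apply: integral_ge0 => s _.
  by rewrite lee_fin powR_ge0.
pose q := p / (p - 1).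
have q0 : 0 < q by rewrite divr_gt0.
have qN0 : q != 0 by rewrite gt_eqF.
pose f := (fun s => s `^ (m / p) * g s) \_ D.
pose h := (fun s => s `^ (- (m / p))) \_ D.
have mf : measurable_fun setT f.
  apply: (measurable_restrictT _ mD).1; apply: measurable_funM => //.
  by apply: measurable_funS (measurable_powR _).
have mh : measurable_fun setT h.
  apply: (measurable_restrictT _ mD).1.
  by apply: measurable_funS (measurable_powR _).
have pq : p^-1 + q^-1 = 1.
  by rewrite /q invf_div; field; exact: pN0.
have := hoelder mu mf mh p0 q0 pq.
set N1 := ('N[mu]_1[_])%E; set Np := ('N[mu]_p%:E[_])%E; set Nq := ('N[mu]_q%:E[_])%E.
have N1E : N1 = (\int[mu]_(s in D) `|g s|%:E)%E.
  rewrite /N1 Lnorm1 [RHS]integral_mkcond; apply: eq_integral => s _ /=.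
  rewrite /f /h !patchE; case: ifPn => [/set_mem Ds|_]; last by rewrite mulr0 normr0.
  rewrite mulrAC -powRD ?subrr ?powRr0 ?mul1r//.
  by rewrite (gt_eqF (D0 _ Ds)) implybT.
have NpE : (Np `^ p = \int[mu]_(s in D) (weighted_pow m p g s)%:E)%E.
  rewrite /Np (poweR_Lnorm mu _ pN0) [RHS]integral_mkcond; apply: eq_integral => s _ /=.
  rewrite /f !patchE; case: ifPn => [/set_mem Ds|_]; last by rewrite normr0 powR0// gt_eqF.
  rewrite /weighted_pow normrM powRM// ger0_norm ?powR_ge0// -powRrM divfK// gt_eqF//.
have NqE : (Nq `^ q <= B%:E)%E.
  rewrite /Nq (poweR_Lnorm mu _ qN0); apply: le_trans intB.
  rewrite [X in (_ <= X)%E]integral_mkcond le_eqVlt; apply/orP; left; apply/eqP.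
  apply: eq_integral => s _ /=.
  rewrite /h !patchE; case: ifPn => [/set_mem Ds|_]; last by rewrite normr0 powR0// gt_eqF.
  rewrite ger0_norm ?powR_ge0// -powRrM; congr (_ `^ _)%:E.
  by rewrite /q; field; rewrite pN0 p1N0.
rewrite N1E => H.
have {H}xN : (`|x|%:E <= Np * Nq)%E by exact: le_trans H.
have Np0 : (0 <= Np)%E by exact: Lnorm_ge0.
have Nq0 : (0 <= Nq)%E by exact: Lnorm_ge0.
rewrite -poweR_EFin.
apply: (@le_trans _ _ ((Np * Nq) `^ p)%E).
  apply: gt0_ler_poweR; rewrite ?in_itv/= ?leey ?andbT ?lee_fin ?mule_ge0 ?(ltW p0)//.
rewrite poweRM// NpE muleC; apply: lee_wpmul2r.
  by apply: integral_ge0 => s _; rewrite lee_fin weighted_pow_ge0.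
(* The conjugate exponent satisfies [p = q (p - 1)], which turns the bound [B] on [Nq ^ q] into
   [B ^ (p - 1)]. *)
have -> : (Nq `^ p = (Nq `^ q) `^ (p - 1))%E by rewrite -poweRrM divfK.
rewrite -poweR_EFin.
apply: gt0_ler_poweR; rewrite ?in_itv/= ?leey ?andbT ?poweR_ge0 ?lee_fin ?(ltW p10)//.
Qed.

(** The power [p - 1] of the factor [1 / (b - 1)] from [integral_powR_le_tail], for
    [b = m / (p - 1)]. *)
Definition hardy_cst p m : R := (m / (p - 1) - 1)^-1 `^ (p - 1).

(** As [p - 1 < m], [integral_powR_le_tail] bounds the dual weight; raising [r ^ (1 - m / (p - 1))]
    to the power [p - 1] gives [r ^ (p - 1 - m)]. *)
Lemma weighted_tail_bound p m r x g : 1 < p -> p - 1 < m -> 0 < r -> r < 1 ->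
  measurable_fun `]r, 1[ g ->
  (`|x|%:E <= \int[mu]_(s in `]r, 1%R[) `|g s|%:E)%E ->
  ((`|x| `^ p)%:E <= (hardy_cst p m * r `^ (p - 1 - m))%:E *
    \int[mu]_(s in `]r, 1%R[) (weighted_pow m p g s)%:E)%E.
Proof.
move=> p1 pm r0 r1 mg xg; have p10 : 0 < p - 1 by lra.
have b1 : 1 < m / (p - 1) by rewrite ltr_pdivlMr// mul1r.
have := weighted_hoelder p1 (ltW r0) mg xg (integral_powR_le_tail b1 r0 r1).
rewrite powRM ?powR_ge0 ?invr_ge0 ?subr_ge0 ?(ltW b1)// -powRrM.
rewrite -/(hardy_cst p m) (mulrC (_ `^ _)) mulrBl mul1r divfK// gt_eqF//.
Qed.

(** Both sides integrate [h r * k s] over the triangle [0 < r < s < 1], which Tonelli's theorem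
    evaluates in either order. *)
Lemma tonelli_triangle (h k : R -> R) (D : set R := `]0%R, 1%R[%classic) :
  measurable_fun D h -> measurable_fun D k ->
  (forall r, 0 <= h r) -> (forall s, 0 <= k s) ->
  let H r := ((h r)%:E * \int[mu]_(s in `]r, 1%R[) (k s)%:E)%E in
  let K s := ((k s)%:E * \int[mu]_(r in `]0%R, s[) (h r)%:E)%E in
  [/\ measurable_fun D H, measurable_fun D K &
      (\int[mu]_(r in D) H r = \int[mu]_(s in D) K s)%E].
Proof.
move=> mh mk h0 k0 H K; have mD : measurable D by exact: measurable_itv.
pose f (z : measurableTypeR R * measurableTypeR R) : \bar R :=
  ((h \_ D) z.1 * (k \_ D) z.2 * (z.1 < z.2)%R%:R)%:E.
have hD0 r : 0 <= (h \_ D) r by rewrite patchE; case: ifP.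
have kD0 r : 0 <= (k \_ D) r by rewrite patchE; case: ifP.
have f0 z : (0 <= f z)%E by rewrite lee_fin !mulr_ge0.
have mf : measurable_fun setT f.
  apply/measurable_EFinP; apply: measurable_funM; first apply: measurable_funM.
  - apply: measurableT_comp; last exact: measurable_fst.
    exact: (measurable_restrictT _ mD).1.
  - apply: measurableT_comp; last exact: measurable_snd.
    exact: (measurable_restrictT _ mD).1.
  - pose A := [set z : measurableTypeR R * measurableTypeR R | z.1 < z.2].
    rewrite (_ : (fun _ => _) = \1_A); last first.
      apply/funext => z; rewrite indicE; congr ((nat_of_bool _)%:R).
      by apply/idP/idP; rewrite inE.
    apply: measurable_indic.
    have := @measurable_fun_ltr _ _ _ setT _ _
      (@measurable_fst _ _ (measurableTypeR R) (measurableTypeR R))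
      (@measurable_snd _ _ (measurableTypeR R) (measurableTypeR R)).
    move=> /(_ measurableT [set true] I); rewrite setTI.
    by congr (measurable _).
have fH r : (\int[mu]_s f (r, s) = (H \_ D) r)%E.
  rewrite patchE; case: ifPn => [/set_mem|rD]; last first.
    rewrite -[RHS](integral0 mu setT); apply: eq_integral => s _.
    by rewrite /f/= patchE (negbTE rD) !mul0r.
  rewrite /D/= in_itv/= => /andP[r0 r1].
  rewrite /H -ge0_integralZl//; last 3 first.
  - apply/measurable_EFinP; apply: measurable_funS mk => //.
    by apply: set_interval.subset_itv; rewrite bnd_simp// ltW.
  - by move=> s _; rewrite lee_fin.
  - by rewrite lee_fin.
  rewrite [RHS]integral_mkcond; apply: eq_integral => s _.
  rewrite /f/= !patchE !mem_setE !in_itv/= r0 r1/=.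
  have [rs|sr] := ltP r s; last by rewrite mulr0.
  rewrite mulr1 (lt_trans r0 rs)/=; case: ifP => _; first by rewrite EFinM.
  by rewrite mulr0.
have fK s : (\int[mu]_r f (r, s) = (K \_ D) s)%E.
  rewrite patchE; case: ifPn => [/set_mem|sD]; last first.
    rewrite -[RHS](integral0 mu setT); apply: eq_integral => r _.
    have kD : (k \_ D) s = 0 by rewrite patchE (negbTE sD).
    by rewrite /f [(r, s).2]/= kD mulr0 mul0r.
  rewrite /D/= in_itv/= => /andP[s0 s1].
  rewrite /K -ge0_integralZl//; last 3 first.
  - apply/measurable_EFinP; apply: measurable_funS mh => //.
    by apply: set_interval.subset_itv; rewrite bnd_simp// ltW.
  - by move=> r _; rewrite lee_fin.
  - by rewrite lee_fin.
  rewrite [RHS]integral_mkcond; apply: eq_integral => r _.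
  rewrite /f/= !patchE !mem_setE !in_itv/= s0 s1/=.
  have [rs|sr] := ltP r s; last by rewrite mulr0 andbF.
  rewrite mulr1 (lt_trans rs s1) !andbT; case: ifP => _.
    by rewrite mulrC EFinM.
  by rewrite mul0r.
split.
- apply: (measurable_restrictT _ mD).2.
  have := @measurable_fun_fubini_tonelli_F _ _ _ _ R mu f mf f0.
  by congr (measurable_fun _ _); apply/funext => r; exact: fH.
- apply: (measurable_restrictT _ mD).2.
  have := @measurable_fun_fubini_tonelli_G _ _ _ _ R mu f mf f0.
  by congr (measurable_fun _ _); apply/funext => s; exact: fK.
- have := @fubini_tonelli _ _ _ _ R mu mu f mf f0.
  have -> : (\int[mu]_x \int[mu]_y f (x, y) = \int[mu]_r (H \_ D) r)%E.
    by apply: eq_integral => r _; exact: fH.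
  have -> : (\int[mu]_y \int[mu]_x f (x, y) = \int[mu]_s (K \_ D) s)%E.
    by apply: eq_integral => s _; exact: fK.
  by rewrite -!integral_mkcond.
Qed.

(** The tail bound inserted for [u r] leaves a double integral over a triangle. After exchange of
    the order, the inner integral of [r ^ (alpha - 1 - m)] over []0, s[] is at most a multiple of
    [s ^ (alpha - m)], which restores the weight [s ^ alpha]. *)
Lemma hardy_inequality p alpha g u : 1 < p -> p - 1 < alpha ->
  measurable_fun (`]0%R, 1%R[ : set R) g -> measurable_fun (`]0%R, 1%R[ : set R) u ->
  (forall r, 0 < r -> r < 1 ->
    (`|u r|%:E <= \int[mu]_(s in `]r, 1%R[) `|g s|%:E)%E) ->
  (\int[mu]_(s in `]0%R, 1%R[) (weighted_pow (alpha - p) p u s)%:E <=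
   (hardy_cst p ((alpha + p - 1) / 2) / ((alpha - p + 1) / 2))%:E *
   \int[mu]_(s in `]0%R, 1%R[) (weighted_pow alpha p g s)%:E)%E.
Proof.
(* Any weight exponent strictly between [p - 1] and [alpha] makes both inner
   power integrals converge. *)
move=> p1 pa mg mur ug; set m := (alpha + p - 1) / 2.
have pm : p - 1 < m by rewrite /m; lra.
have m0 : 0 < m by lra.
pose K := hardy_cst p m; have K0 : 0 <= K by rewrite powR_ge0.
pose c := alpha - 1 - m.
have c1 : -1 < c by rewrite /c /m; lra.
pose h (r : R) := K * r `^ c.
have mh : measurable_fun (`]0%R, 1%R[ : set R) h.
  apply: measurable_funM => //; apply: measurable_funS (measurable_powR c) => //.
have h0 r : 0 <= h r by rewrite mulr_ge0 ?powR_ge0.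
pose k := weighted_pow m p g.
have mk : measurable_fun (`]0%R, 1%R[ : set R) k by exact: measurable_weighted_pow.
have k0 s : 0 <= k s by exact: weighted_pow_ge0.
have mgr r : 0 < r -> measurable_fun `]r, 1[ g.
  move=> r0; apply: measurable_funS mg => //.
  by apply: set_interval.subset_itv; rewrite bnd_simp// ltW.
rewrite -ge0_integralZl//; last 3 first.
- by apply/measurable_EFinP; exact: measurable_weighted_pow.
- by move=> s _; rewrite lee_fin weighted_pow_ge0.
- by rewrite lee_fin divr_ge0//; lra.
have tonelli := tonelli_triangle mh mk h0 k0.
apply: (@le_trans _ _ (\int[mu]_(r in `]0%R, 1%R[)
    ((h r)%:E * \int[mu]_(s in `]r, 1%R[) (k s)%:E))%E).
  apply: ge0_le_integral.
  - exact: measurable_itv.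
  - by move=> r _; rewrite lee_fin weighted_pow_ge0.
  - by apply/measurable_EFinP; exact: measurable_weighted_pow.
  - have [mH _ _] := tonelli; exact: mH.
  move=> r /=; rewrite in_itv/= => /andP[r0 r1].
  have -> : ((h r)%:E = (r `^ (alpha - p))%:E * (K * r `^ (p - 1 - m))%:E)%E.
    rewrite -EFinM mulrCA -powRD; last by rewrite (gt_eqF r0) implybT.
    by rewrite /h /c; congr (_ * _ `^ _)%:E; ring.
  rewrite -muleA /weighted_pow EFinM; apply: lee_wpmul2l; first by rewrite lee_fin powR_ge0.
  exact: weighted_tail_bound p1 pm r0 r1 (mgr r r0) (ug _ r0 r1).
have [_ _ ->] := tonelli.
apply: ge0_le_integral.
- exact: measurable_itv.
- move=> s _; rewrite mule_ge0 ?lee_fin//; apply: integral_ge0 => r _.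
  by rewrite lee_fin.
- have [_ mK _] := tonelli; exact: mK.
- apply/measurable_EFinP; apply: measurable_funM; first exact: measurable_cst.
  by apply: measurable_weighted_pow; [exact: measurable_itv|exact: mg].
move=> s /=; rewrite in_itv/= => /andP[s0 s1].
rewrite /h; under eq_integral do rewrite EFinM.
rewrite ge0_integralZl//; last 2 first.
- exact: (measurable_powR_EFin c (measurable_itv `]0, s[)).
- by move=> r _; rewrite lee_fin powR_ge0.
have H := integral_powR_le_head c1 s0.
apply: (@le_trans _ _ ((k s)%:E * (K%:E * (s `^ (c + 1) / (c + 1))%:E))%E).
  by apply: lee_wpmul2l; rewrite ?lee_fin//; apply: lee_wpmul2l; rewrite ?lee_fin.
rewrite -!EFinM lee_fin /k /weighted_pow le_eqVlt; apply/orP; left; apply/eqP.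
have <- : c + 1 = (alpha - p + 1) / 2 by rewrite /c /m; lra.
have -> : s `^ alpha = s `^ m * s `^ (c + 1).
  rewrite -powRD; last by rewrite (gt_eqF s0) implybT.
  by congr (_ `^ _); rewrite /c; ring.
by rewrite -/K; ring.
Qed.

End WeightedHardy.

(** * Behaviour near 1 of functions in the closure, and radial bounds *)

Section RadialBounds.
Context {R : realType}.
Notation mu := (@lebesgue_measure R).
Notation I01 := (`]0%R, 1%R[%classic : set R).
Implicit Types (p q m r s t x y alpha gamma : R) (u v w f : R -> R).

Lemma le_powRV p x y : 0 < p -> 0 <= x -> x `^ p <= y -> x <= y `^ p^-1.
Proof.
move=> p0 x0 xy; rewrite -[x in x <= _]powRr1// -(divff (lt0r_neq0 p0)) powRrM.
apply: ge0_ler_powR; rewrite ?nnegrE ?powR_ge0 ?invr_ge0 ?(ltW p0)//.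
exact: le_trans (powR_ge0 _ _) xy.
Qed.

Lemma wLnorm_powE q gamma f : q != 0 ->
  (wLnorm q gamma f `^ q = \int[mu]_(r in I01) (weighted_pow gamma q f r)%:E)%E.
Proof.
move=> q0; rewrite /wLnorm -poweRrM mulVf// poweRe1//.
by apply: integral_ge0 => r _; rewrite lee_fin mulr_ge0 ?powR_ge0.
Qed.

Lemma AC_loc01_ac_seq f r s : AC_loc01 f -> 0 < r -> r < s -> s < 1 -> ac_seq r s f.
Proof. by move=> acf r0 rs s1; apply: abs_continuous_ac_seq; exact: acf. Qed.

(** On []r, s[] the dual weight is at most its value at [r], so Hoelder's inequality applies with
    that value times the length. The energy over []r, s[] is then enlarged to []0, 1[]. *)
Lemma increment_bound p alpha w r s : 1 < p -> 0 <= alpha -> 0 < r -> r < s ->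
  s <= 1 -> ac_seq r s w ->
  ((`|w s - w r| `^ p)%:E <= ((s - r) `^ (p - 1) * r `^ (- alpha))%:E *
    \int[mu]_(x in I01) (weighted_pow alpha p (derive1 w) x)%:E)%E.
Proof.
move=> p1 alpha0 r0 rs s1 acw; have p10 : 0 < p - 1 by lra.
have p1N0 := lt0r_neq0 p10.
have [g [mg aeg wg]] := ac_le_integral (ltW rs) acw.
have mgrs : measurable_fun `]r, s[ g by exact: measurable_funS mg.
have intB : (\int[mu]_(x in `]r, s[) (x `^ (- (alpha / (p - 1))))%:E <=
    ((s - r) * r `^ (- (alpha / (p - 1))))%:E)%E.
  have muE : (mu `]r, s[%classic = (s - r)%:E)%E.
    by rewrite lebesgue_measure_itv/= lte_fin rs EFinB.
  have <- : (\int[mu]_(x in `]r, s[) cst (r `^ (- (alpha / (p - 1))))%:E x =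
      ((s - r) * r `^ (- (alpha / (p - 1))))%:E)%E.
    rewrite integral_cst// (mulrC (s - r)) EFinM; congr (_ * _)%E; exact: muE.
  apply: ge0_le_integral => //.
  - by move=> x _; rewrite lee_fin powR_ge0.
  - exact: measurable_powR_EFin.
  move=> x /=; rewrite in_itv/= => /andP[rx _]; rewrite lee_fin.
  have x0 := lt_trans r0 rx; rewrite !powRN lef_pV2 ?posrE ?powR_gt0//.
  apply: ge0_ler_powR; rewrite ?nnegrE ?(ltW r0) ?(ltW x0) ?(ltW rx)//.
  by rewrite divr_ge0// ltW.
apply: le_trans (weighted_hoelder p1 (ltW r0) mgrs wg intB) _.
have sr0 : 0 <= s - r by rewrite subr_ge0 ltW.
rewrite (powRM _ sr0 (powR_ge0 _ _)) -powRrM mulNr (divfK p1N0).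
apply: lee_wpmul2l; first by rewrite lee_fin mulr_ge0 ?powR_ge0.
have sub : `]r, s[%classic `<=` I01.
  by apply: set_interval.subset_itv; rewrite bnd_simp// ltW.
apply: (@le_trans _ _ (\int[mu]_(x in I01)
    ((EFin \o weighted_pow alpha p g) \_ `]r, s[) x)%E).
  rewrite le_eqVlt; apply/orP; left; apply/eqP.
  by rewrite [RHS]integral_mkcond -patch_setI setIidr// -integral_mkcond.
apply: ge0_ae_le_integral => //.
- apply: measurable_funS (measurableT) _ _ => //.
  apply: (measurable_restrictT _ (measurable_itv _)).1.
  by apply/measurable_EFinP; apply: measurable_weighted_pow => //.
- by move=> x; rewrite lee_fin weighted_pow_ge0.
- by move=> x; rewrite patchE; case: ifP => // _; rewrite lee_fin weighted_pow_ge0.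
- move: aeg; apply: filterS; first exact: (ae_filter_ringOfSetsType mu).
  move=> x H Dx; rewrite patchE; case: ifPn => [/set_mem xrs|_].
    by rewrite /= /weighted_pow (H xrs).
  by rewrite lee_fin weighted_pow_ge0.
Qed.

(** Closeness in the Sobolev norm is turned into uniform closeness near 1. For [w = u - v] with [v]
    vanishing at 1, the norm of [w] yields one point of []1 / 2, 3 / 4[] where [w] is small, and the
    derivative norm carries this smallness up to 1. *)
Lemma X1p_near1_small p alpha0 alpha1 u : 1 < p -> 0 <= alpha0 -> 0 <= alpha1 ->
  X1p p alpha0 alpha1 u -> forall e, 0 < e ->
  exists2 t, t < 1 & forall s, t < s -> s < 1 -> `|u s| <= e.
Proof.
move=> p1 alpha00 alpha10 [[acu mu1 mu2] uX] e e0.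
have p0 : 0 < p by lra.
have pN0 := lt0r_neq0 p0.
(* [M0] accounts for the length 1/4 of []1 / 2, 3 / 4[] and for the weight there, at least
   [2 ^ (- alpha0)]; [N0] accounts for [s0 ^ (- alpha1)], at most [2 ^ alpha1]. *)
pose M0 := (4 * 2 `^ alpha0) `^ p^-1; pose N0 := (2 `^ alpha1) `^ p^-1.
have M00 : 0 <= M0 by rewrite powR_ge0.
have N00 : 0 <= N0 by rewrite powR_ge0.
have [eta eta0 etaE] : exists2 eta, 0 < eta & (M0 + N0) * eta <= e / 2.
  have MN0 : 0 < M0 + N0 + 1 by lra.
  exists (e / 2 / (M0 + N0 + 1)); first by rewrite !divr_gt0.
  rewrite mulrCA ler_piMr ?divr_ge0 ?(ltW e0)//.
  by rewrite ler_pdivrMr// mul1r lerDl.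
have [v [[acv mv1 mv2] v1] uv] := uX _ eta0.
set w := (u \- v) in uv.
have acw r s : 0 < r -> r < s -> s < 1 -> ac_seq r s w.
  by move=> r0 rs s1; apply: ac_seqD; [|apply: ac_seqN]; exact: AC_loc01_ac_seq.
have [Aw Bw] : (\int[mu]_(x in I01) (weighted_pow alpha0 p w x)%:E < (eta `^ p)%:E)%E /\
  (\int[mu]_(x in I01) (weighted_pow alpha1 p (derive1 w) x)%:E < (eta `^ p)%:E)%E.
  have wpow0 gamma f : (0 <= \int[mu]_(x in I01) (weighted_pow gamma p f x)%:E)%E.
    by apply: integral_ge0 => x _; rewrite lee_fin weighted_pow_ge0.
  have AB : (\int[mu]_(x in I01) (weighted_pow alpha0 p w x)%:E +
      \int[mu]_(x in I01) (weighted_pow alpha1 p (derive1 w) x)%:E < (eta `^ p)%:E)%E.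
    rewrite -(wLnorm_powE alpha0 w pN0) -(wLnorm_powE alpha1 (derive1 w) pN0).
    rewrite ltNge; apply/negP => etaw; move: uv; apply/negP; rewrite -leNgt.
    rewrite -[eta in leLHS]powRr1 ?(ltW eta0)// -(divff pN0) powRrM -poweR_EFin.
    apply: gt0_ler_poweR; rewrite ?in_itv/= ?leey ?andbT ?invr_ge0 ?(ltW p0)//.
      by rewrite lee_fin powR_ge0.
    by rewrite adde_ge0 ?poweR_ge0.
  split; apply: le_lt_trans AB; first exact: leeDl (wpow0 _ _).
  exact: leeDr (wpow0 _ _).
(* Otherwise [|w|] exceeds [M0 eta] on an interval of length 1/4, where the integrand is then at
   least [4 eta ^ p], against the bound [Aw]. *)
have [s0 [s0l s0r ws0]] : exists s0, [/\ 1 / 2 < s0, s0 < 3 / 4 & `|w s0| <= M0 * eta].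
  apply: contrapT => H.
  have {}H s : 1 / 2 < s -> s < 3 / 4 -> M0 * eta < `|w s|.
    move=> s1 s2; rewrite ltNge; apply/negP => h; apply: H; exists s; split => //.
  move: Aw; apply/negP; rewrite -leNgt.
  pose J : set R := `]1 / 2, 3 / 4[%classic.
  have mJ : measurable J by exact: measurable_itv.
  have muJ : (mu J = 4^-1%:E)%E.
    rewrite /J lebesgue_measure_itv/= lte_fin ifT; last by lra.
    by rewrite -EFinD; congr (_%:E); lra.
  have JI : J `<=` I01 by apply: set_interval.subset_itv; rewrite bnd_simp; lra.
  pose c : \bar R := (4 * eta `^ p)%:E.
  have c0 : (0 <= c)%E by rewrite lee_fin mulr_ge0 ?powR_ge0.
  apply: (@le_trans _ _ (\int[mu]_(x in I01) ((cst c) \_ J) x)%E).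
    have -> : (\int[mu]_(x in I01) ((cst c) \_ J) x = \int[mu]_(x in J) cst c x)%E.
      by rewrite [LHS]integral_mkcond -patch_setI setIidr// -integral_mkcond.
    rewrite integral_cst//.
    have -> : (c * lebesgue_measure J = (eta `^ p)%:E)%E.
      by rewrite muJ -EFinM mulrAC divff ?mul1r.
    exact: lexx.
  apply: ge0_ae_le_integral => //.
  - apply: (measurable_funS measurableT) => //.
    exact: (measurable_restrictT _ mJ).1.
  - by move=> x; rewrite lee_fin weighted_pow_ge0.
  - by move=> x; rewrite patchE; case: ifP.
  apply: aeW => x _; rewrite patchE; case: ifPn => [/set_mem|_]; last first.
    by rewrite lee_fin weighted_pow_ge0.
  rewrite /J/= in_itv/= => /andP[x1 x2]; rewrite lee_fin.
  have x0 : 0 < x by lra.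
  apply: (@le_trans _ _ (2^-1 `^ alpha0 * (M0 * eta) `^ p)).
    rewrite powRM ?(ltW eta0)// -powRrM mulVf// powRr1 ?mulr_ge0 ?powR_ge0//.
    rewrite mulrA mulrCA -powRM// mulVf// powR1 mulr1//.
  apply: ler_pM; rewrite ?powR_ge0//.
    by apply: ge0_ler_powR; rewrite ?nnegrE//; lra.
  apply: ge0_ler_powR; rewrite ?nnegrE ?(ltW p0) ?(mulr_ge0 M00 (ltW eta0))//.
  by rewrite ltW ?H.
have ws s : 3 / 4 < s -> s < 1 -> `|w s| <= (M0 + N0) * eta.
  move=> s34 s1; have ss0 : s0 < s by lra.
  have s00 : 0 < s0 by lra.
  have := increment_bound p1 alpha10 s00 ss0 (ltW s1) (acw _ _ s00 ss0 s1).
  move=> H; have {H} : ((`|w s - w s0| `^ p)%:E <= (2 `^ alpha1 * eta `^ p)%:E)%E.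
    apply: le_trans H _; rewrite [X in (_ <= X)%E]EFinM; apply: lee_pmul; rewrite ?lee_fin.
    - by rewrite mulr_ge0 ?powR_ge0.
    - by apply: integral_ge0 => x _; rewrite lee_fin weighted_pow_ge0.
    - rewrite -[leRHS]mul1r; apply: ler_pM; rewrite ?powR_ge0//.
        apply: (@le_trans _ _ (1 `^ (p - 1))); last by rewrite powR1.
        apply: ge0_ler_powR; rewrite ?nnegrE; lra.
      rewrite -mulN1r powRrM powR_inv1 ?(ltW s00)//.
      have s02 : s0^-1 <= 2 by rewrite -[leRHS]invrK lef_pV2 ?posrE//; lra.
      by apply: ge0_ler_powR; rewrite ?nnegrE ?invr_ge0 ?(ltW s00).
    - exact: ltW.
  rewrite lee_fin => /(le_powRV p0 (normr_ge0 _)).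
  rewrite powRM ?powR_ge0// -[_ `^ p `^ p^-1]powRrM divff// (powRr1 (ltW eta0)) => H.
  have -> : w s = w s0 + (w s - w s0) by ring.
  by apply: le_trans (ler_normD _ _) _; rewrite mulrDl lerD.
have [d /= d0 vd] : \forall s \near 1^'-, `|v s| < e / 2.
  have := v1; move/cvgrPdist_lt => /(_ (e / 2)); rewrite divr_gt0// => /(_ isT).
  by apply: filterS => s; rewrite sub0r normrN.
exists (Num.max (3 / 4) (1 - d)) => [|s].
  by rewrite gt_max; apply/andP; split; lra.
rewrite gt_max => /andP[s34 sd] s1.
have -> : u s = v s + w s by rewrite /w/=; ring.
apply: le_trans (ler_normD _ _) _; rewrite [leRHS](splitr e); apply: lerD.
  by apply/ltW/vd => //=; rewrite /ball/= ger0_norm; lra.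
exact: le_trans (ws _ s34 s1) etaE.
Qed.

(** Both estimates hold on [[r, s]] up to the term [|u s|], which can be made arbitrarily small by
    taking [s] close to 1. *)
Lemma X1p_radial p alpha0 alpha1 u : 1 < p -> 0 <= alpha0 -> 0 <= alpha1 ->
  X1p p alpha0 alpha1 u -> grad_norm p alpha1 u = 1%E ->
  forall r, 0 < r -> r < 1 ->
  (`|u r|%:E <= \int[mu]_(s in `]r, 1%R[) `|derive1 u s|%:E)%E /\
  `|u r| <= ((1 - r) `^ (p - 1) * r `^ (- alpha1)) `^ p^-1.
Proof.
move=> p1 alpha00 alpha10 uX u1 r r0 r1; have p0 : 0 < p by lra.
have small e : 0 < e -> exists s, [/\ r < s, s < 1 & `|u s| <= e].
  move=> e0; have [t t1 us] := X1p_near1_small p1 alpha00 alpha10 uX e0.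
  have m1 : Num.max r t < 1 by rewrite gt_max r1.
  have [h1 h2] := midf_lt m1; rewrite gt_max in h1; case/andP: h1 => rs ts.
  by exists ((Num.max r t + 1) / 2); split => //; exact: us.
have [[acu _ [mu' _]] _] := uX.
have acrs s : r < s -> s < 1 -> ac_seq r s u.
  by move=> rs s1; exact: AC_loc01_ac_seq.
split.
  apply/lee_addgt0Pr => e e0; have [s [rs s1 us]] := small e e0.
  have -> : u r = u s - (u s - u r) by ring.
  apply: (@le_trans _ _ (`|u s - u r|%:E + e%:E)%E).
    by rewrite -EFinD lee_fin (le_trans (ler_normB _ _))// addrC lerD.
  apply: leeD => //; apply: le_trans (ac_le_integral_derive (ltW rs) (acrs s rs s1)) _.
  apply: ge0_subset_integral => //=.
  - apply/measurable_EFinP/measurableT_comp => //; apply: measurable_funS mu' => //.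
    by apply: set_interval.subset_itv; rewrite bnd_simp// ltW.
  - by apply: set_interval.subset_itv; rewrite bnd_simp// ltW.
apply/ler_addgt0Pr => e e0; have [s [rs s1 us]] := small e e0.
have -> : u r = u s - (u s - u r) by ring.
apply: (le_trans (ler_normB _ _)); rewrite addrC lerD//.
apply: le_powRV => //.
have := increment_bound p1 alpha10 r0 rs (ltW s1) (acrs s rs s1).
rewrite -(wLnorm_powE _ _ (lt0r_neq0 p0)) -/(grad_norm _ _ _) u1 poweR1r mule1 lee_fin.
move=> /le_trans; apply; apply: ler_wpM2r; rewrite ?powR_ge0//.
by apply: ge0_ler_powR; rewrite ?nnegrE; lra.
Qed.

End RadialBounds.

(** * Pointwise domination of the integrand *)

Section PointwiseBound.
Context {R : realType}.
Implicit Types (r y : R).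
Variables (p alpha theta tau C : R) (phi : R -> R).
Hypotheses (p1 : 1 < p) (alpha0 : 0 <= alpha) (theta0 : 0 <= theta).
Hypotheses (sob : 0 < alpha - p + 1) (alpha_theta : alpha - p < theta).
Hypotheses (tau0 : 0 < tau) (C0 : 0 <= C).
Hypothesis phi_gt0 : forall r, 0 < r -> r < 1 -> 0 < phi r.

Let a := alpha - p + 1.
Let q := crit_exp p alpha theta.

Let p0 : 0 < p. Proof. exact: lt_trans p1. Qed.
Let aN0 : a != 0. Proof. exact: lt0r_neq0. Qed.

Let qE : q * (a / p) = theta + 1.
Proof. by rewrite /q /crit_exp -/a; field; rewrite aN0 lt0r_neq0. Qed.

Let pq : p < q.
Proof.
rewrite /q /crit_exp ltr_pdivlMr// mulrC ltr_pM2r//.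
by have := alpha_theta; lra.
Qed.

Let q0 : 0 < q. Proof. exact: lt_trans pq. Qed.

(** The real [y] plays the role of [|u r|], so that the estimates below involve numbers only. *)
Let logfactor r y : R := `|ln (tau + y)| `^ phi r.
Let integrand r y : R := r `^ theta * y `^ q * logfactor r y.

Let A := `|ln tau| + `|ln (tau + C)|.

Let A0 : 0 <= A. Proof. by rewrite addr_ge0. Qed.

(** From below, [tau + y] is at least [tau]; from above, it is at most [(tau + C) r ^ (- a / p)],
    because [r ^ (- a / p)] is at least 1. [A] absorbs the logarithms of both constants. *)
Let log_bound r y : 0 < r -> r < 1 -> 0 <= y -> y <= C * r `^ (- (a / p)) ->
  `|ln (tau + y)| <= A + a / p * `|ln r|.
Proof.
have [Cge tau_gt] := (C0, tau0); move=> r0 r1 y0 yC; have lr : ln r <= 0 by apply: ln_le0; exact: ltW.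
have ap0 : 0 <= a / p by rewrite divr_ge0 ?ltW.
have rap : 1 <= r `^ (- (a / p)).
  rewrite powRN invf_ge1 ?powR_gt0// -(powRr0 r).
  by apply: ger_powR; rewrite ?r0 ?(ltW r1).
have tC : 0 < tau + C by lra.
have up : ln (tau + y) <= ln (tau + C) + a / p * `|ln r|.
  have -> : ln (tau + C) + a / p * `|ln r| = ln ((tau + C) * r `^ (- (a / p))).
    by rewrite lnM ?posrE ?powR_gt0// ln_powR ler0_norm// mulrN mulNr.
  rewrite ler_ln ?posrE ?mulr_gt0 ?powR_gt0//; last by lra.
  by rewrite mulrDl lerD// ler_peMr// ltW.
have lo : ln tau <= ln (tau + y) by rewrite ler_ln ?posrE//; lra.
have := ler_norm (ln (tau + C)); have := ler_norm (- ln tau).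
have : 0 <= a / p * `|ln r| by rewrite mulr_ge0.
rewrite normrN /A ler_norml => h1 h2 h3.
have := normr_ge0 (ln (tau + C)); have := normr_ge0 (ln tau).
by move=> h4 h5; apply/andP; split; lra.
Qed.

Let logfactor_le r y M : 0 < r -> r < 1 -> 0 < M -> `|ln (tau + y)| <= M ->
  logfactor r y <= expR (phi r * ln M).
Proof.
move=> r0 r1 M0 lM; have phir := phi_gt0 r0 r1.
have -> : expR (phi r * ln M) = M `^ phi r by rewrite /powR gt_eqF.
by apply: ge0_ler_powR; rewrite ?nnegrE ?(ltW phir) ?(ltW M0).
Qed.

(** For small [r], both [|ln r| ^ sigma] and [ln |ln r|] exceed 1, so the hypothesis bounds
    [phi r * ln |ln r|] as well as [phi r] by [c]. These control the exponent
    [phi r * ln (N * |ln r|)]. *)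
Let logfactor_bounded_near0 :
  (exists c sigma : R, [/\ 0 < c, 1 < sigma &
     \forall r \near 0^'+, phi r * `|ln r| `^ sigma * ln `|ln r| <= c]) ->
  exists d K : R, [/\ 0 < d, d < 1, 0 <= K &
    forall r y, 0 < r -> r < d -> 0 <= y -> y <= C * r `^ (- (a / p)) ->
      logfactor r y <= K].
Proof.
have Age := A0; move=> [c [sigma [c0 sigma1 [d /= d0 dphi]]]].
pose N := A + a / p + 1.
have ap0 : 0 <= a / p by rewrite divr_ge0 ?ltW.
have N1 : 1 <= N by rewrite /N; lra.
have lnN : 0 <= ln N by rewrite ln_ge0.
(* Below [expR (- expR 1)] one has [ln |ln r| > 1]; [d / 2] keeps [r] inside the neighbourhood where
   the hypothesis holds. *)
exists (Num.min (d / 2) (expR (- expR 1))), (expR (c * ln N + c)).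
have d1 : expR (- expR 1) < 1 :> R by rewrite expR_lt1 oppr_lt0 expR_gt0.
split.
- by rewrite lt_min expR_gt0 divr_gt0.
- by rewrite gt_min d1 orbT.
- exact: expR_ge0.
move=> r y r0; rewrite lt_min => /andP[rd re] y0 yC.
have r1 : r < 1 by exact: lt_trans d1.
have lnr : expR 1 < `|ln r|.
  rewrite ltr0_norm; last by rewrite ln_lt0// r0.
  by rewrite ltrNr -[ltRHS]expRK ltr_ln ?posrE ?expR_gt0.
have lnr1 : 1 < `|ln r|.
  by apply: lt_trans lnr; rewrite expR_gt1.
have lnlnr : 1 < ln `|ln r|.
  by rewrite -[ltLHS]expRK ltr_ln ?posrE ?expR_gt0// (lt_trans _ lnr1).
have phir := phi_gt0 r0 r1.
have philn : phi r * ln `|ln r| <= c.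
  have : phi r * `|ln r| `^ sigma * ln `|ln r| <= c.
    by apply: dphi => //=; rewrite /ball/= sub0r normrN gtr0_norm//; lra.
  apply: le_trans; rewrite ler_pM2r ?(lt_trans _ lnlnr)// ler_peMr ?(ltW phir)//.
  by rewrite -(powRr0 `|ln r|) ler_powR ?ltW//; lra.
have phic : phi r <= c.
  by apply: le_trans philn; rewrite ler_peMr ?ltW.
apply: (@le_trans _ _ (expR (phi r * ln (N * `|ln r|)))).
  apply: logfactor_le => //.
    by rewrite mulr_gt0 ?(lt_le_trans _ N1) ?(lt_trans _ lnr1).
  apply: le_trans (log_bound r0 r1 y0 yC) _.
  have AL : A <= A * `|ln r| by rewrite ler_peMr// ltW.
  have -> : N * `|ln r| = A * `|ln r| + a / p * `|ln r| + `|ln r|.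
    by rewrite /N (mulrDl (A + a / p) 1) (mulrDl A (a / p)) mul1r.
  set x := a / p * `|ln r|; set L := `|ln r| in AL *; have L0 : 0 <= L by exact: normr_ge0.
  by move: AL; set Y := A * L; move: x Y => x Y AL; lra.
rewrite ler_expR lnM ?posrE ?(lt_le_trans _ N1) ?(lt_trans _ lnr1)//.
by rewrite mulrDr lerD// ler_wpM2r.
Qed.

(** The excess power [y ^ (q - p)] is estimated by the radial bound; by [qE] this costs
    [r ^ (a - theta - 1)], which changes the weight from [r ^ theta] to [r ^ (alpha - p)]. *)
Let integrand_le_near0 r y K : 0 < r -> 0 <= y ->
  y <= C * r `^ (- (a / p)) -> logfactor r y <= K ->
  integrand r y <= K * C `^ (q - p) * (r `^ (alpha - p) * y `^ p).
Proof.
move=> r0 y0 yC fK; have K0 : 0 <= K by apply: le_trans fK; exact: powR_ge0.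
have qp : 0 < q - p by rewrite subr_gt0.
rewrite /integrand; have -> : y `^ q = y `^ p * y `^ (q - p).
  have [->|yN0] := eqVneq y 0; first by rewrite !powR0 ?mul0r// lt0r_neq0.
  by rewrite -powRD ?yN0 ?implybT// addrC subrK.
have yqp : y `^ (q - p) <= C `^ (q - p) * r `^ (a - (theta + 1)).
  have -> : a - (theta + 1) = - (a / p) * (q - p).
    by rewrite mulrBr mulNr [a / p * q]mulrC qE mulNr divfK ?lt0r_neq0//; ring.
  rewrite powRrM -powRM ?powR_ge0//.
  by apply: ge0_ler_powR; rewrite ?nnegrE ?mulr_ge0 ?powR_ge0 ?(ltW qp).
rewrite mulrC -mulrA; apply: ler_pM => //; first exact: powR_ge0.
  by rewrite !mulr_ge0 ?powR_ge0.
have -> : r `^ (alpha - p) = r `^ theta * r `^ (a - (theta + 1)).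
  rewrite -powRD; last by rewrite (gt_eqF r0) implybT.
  by congr (_ `^ _); rewrite /a; ring.
rewrite mulrA [leLHS]mulrC; set z := r `^ theta * y `^ p.
have -> : C `^ (q - p) * (r `^ theta * r `^ (a - (theta + 1)) * y `^ p) =
  C `^ (q - p) * r `^ (a - (theta + 1)) * z by rewrite /z; ring.
by apply: ler_wpM2r => //; rewrite mulr_ge0 ?powR_ge0.
Qed.

(** The interval is cut at a point [t] near 1. Up to [t], compactness bounds [phi] and the radial
    bound at [d] bounds [y]; beyond [t], the factor [M ^ phi r] is at most [(1 - r) ^ (- kappa)],
    which the decay of [y ^ q] compensates. *)
Let integrand_le_away0 d : 0 < d -> d < 1 ->
  {within `[0, 1[%classic, continuous phi} ->
  phi r / `|ln (1 - r)| @[r --> 1^'-] --> (0 : R) ->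
  exists2 K, 0 <= K & forall r y, d <= r -> r < 1 -> 0 <= y ->
    y <= C * r `^ (- (a / p)) ->
    y <= ((1 - r) `^ (p - 1) * r `^ (- alpha)) `^ p^-1 -> integrand r y <= K.
Proof.
move=> d0 d1 phi_cont phi_near1.
have ap0 : 0 <= a / p by rewrite divr_ge0 ?ltW.
pose M := A + a / p * `|ln d| + 1.
have M1 : 1 <= M by rewrite lerDr addr_ge0// mulr_ge0.
have M0 : 0 < M by exact: lt_le_trans M1.
have lnM0 : 0 <= ln M by rewrite ln_ge0.
have factor_le r y : d <= r -> r < 1 -> 0 <= y -> y <= C * r `^ (- (a / p)) ->
    logfactor r y <= expR (phi r * ln M).
  move=> dr r1 y0 yC; have r0 : 0 < r by exact: lt_le_trans dr.
  apply: logfactor_le => //; apply: le_trans (log_bound r0 r1 y0 yC) _.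
  apply: (@le_trans _ _ (A + a / p * `|ln d|)); last by rewrite lerDl.
  rewrite lerD2l ler_wpM2l// !ler0_norm ?ln_le0 ?(ltW r1) ?(ltW d1)//.
  by rewrite lerN2 ler_ln.
have rtheta r : d <= r -> r < 1 -> 0 <= r `^ theta <= 1.
  move=> dr r1; rewrite powR_ge0/= -(powRr0 r); apply: ger_powR => //.
  by rewrite (lt_le_trans d0 dr) ltW.
pose kappa := (p - 1) * (q / p).
have kappa0 : 0 < kappa by apply: mulr_gt0; [rewrite subr_gt0|exact: divr_gt0 q0 p0].
(* Chosen so that [eps] times [ln M + 1] is [kappa]; the summand 1 keeps the divisor positive, as
   [ln M] is only known to be nonnegative. *)
pose eps := kappa / (ln M + 1).
have eps0 : 0 < eps by apply: divr_gt0 => //; rewrite ltr_wpDl.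
have [e /= e0 near1] : \forall r \near 1^'-, phi r / `|ln (1 - r)| < eps.
  have := phi_near1; move/cvgrPdist_lt => /(_ eps eps0).
  by apply: filterS => r; rewrite sub0r normrN; apply: le_lt_trans; exact: ler_norm.
pose t := Num.max d (1 - e / 2).
have td : d <= t by rewrite le_max lexx.
have t1 : t < 1 by rewrite gt_max d1; lra.
have [s _ phis] : exists2 s, s \in `[0, t] & forall r, r \in `[0, t] -> phi r <= phi s.
  apply: EVT_max; first by rewrite (le_trans _ td)// ltW.
  apply: continuous_subspaceW phi_cont.
  by apply: set_interval.subset_itv => //; rewrite bnd_simp.
pose Ymid := C * d `^ (- (a / p)).
have Ymid0 : 0 <= Ymid by rewrite mulr_ge0 ?powR_ge0.
pose Kmid := Ymid `^ q * expR (phi s * ln M).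
pose Kend := (d `^ (- alpha)) `^ (q / p).
exists (Kmid + Kend); first by rewrite addr_ge0 ?mulr_ge0 ?powR_ge0 ?expR_ge0.
move=> r y dr r1 y0 yC yend; have r0 : 0 < r by exact: lt_le_trans dr.
have [_ rt1] := andP (rtheta r dr r1).
apply: (@le_trans _ _ (y `^ q * expR (phi r * ln M))).
  rewrite /integrand -mulrA -[leRHS]mul1r; apply: ler_pM; rewrite ?mulr_ge0 ?powR_ge0//.
  by apply: ler_wpM2l; [exact: powR_ge0|exact: factor_le].
have [rt|tr] := leP r t.
  apply: ler_wpDr; first exact: powR_ge0.
  rewrite /Kmid; apply: ler_pM; [exact: powR_ge0|exact: expR_ge0| |].
    apply: ge0_ler_powR; rewrite ?nnegrE ?(ltW q0)//.
    apply: le_trans yC _; apply: ler_wpM2l => //.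
    rewrite !powRN lef_pV2 ?posrE ?powR_gt0//.
    by apply: ge0_ler_powR; rewrite ?nnegrE ?(ltW d0) ?(ltW r0).
  by rewrite ler_expR ler_wpM2r// phis// in_itv/= (ltW r0).
apply: ler_wpDl.
  by apply: mulr_ge0; [exact: powR_ge0|exact: expR_ge0].
have r10 : 0 < 1 - r by rewrite subr_gt0.
have r11 : 1 - r < 1 by rewrite ltrBlDr ltrDl.
have lnr : ln (1 - r) < 0 by rewrite ln_lt0// r10.
have phir : phi r * ln M <= - (kappa * ln (1 - r)).
  have : phi r / `|ln (1 - r)| < eps.
    apply: near1 => //=; rewrite /ball/= gtr0_norm//.
    by move: tr; rewrite gt_max => /andP[_]; lra.
  rewrite ltr0_norm// ltr_pdivrMr ?oppr_gt0// => h.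
  apply: (@le_trans _ _ (eps * - ln (1 - r) * (ln M + 1))).
    apply: ler_pM => //; [exact/ltW/phi_gt0|exact: ltW|by rewrite lerDl].
  by rewrite mulrAC /eps divfK ?mulrN// lt0r_neq0// ltr_wpDl.
have yq : y `^ q <= (1 - r) `^ kappa * Kend.
  apply: (@le_trans _ _ ((((1 - r) `^ (p - 1) * r `^ (- alpha)) `^ p^-1) `^ q)).
    by apply: ge0_ler_powR; rewrite ?nnegrE ?powR_ge0 ?(ltW q0).
  rewrite -powRrM (mulrC p^-1) (powRM _ (powR_ge0 _ _) (powR_ge0 _ _)).
  rewrite -(powRrM (1 - r)) -/kappa.
  apply: ler_wpM2l; first exact: powR_ge0.
  have rd : r `^ (- alpha) <= d `^ (- alpha).
    rewrite !powRN lef_pV2 ?posrE ?powR_gt0//.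
    by apply: ge0_ler_powR; rewrite ?nnegrE ?(ltW d0) ?(ltW r0).
  apply: ge0_ler_powR rd; rewrite ?nnegrE ?powR_ge0//.
  exact: divr_ge0 (ltW q0) (ltW p0).
apply: (@le_trans _ _ ((1 - r) `^ kappa * Kend * expR (- (kappa * ln (1 - r))))).
  by apply: ler_pM; [exact: powR_ge0|exact: expR_ge0|exact: yq|rewrite ler_expR].
have -> : (1 - r) `^ kappa = expR (kappa * ln (1 - r)) by rewrite /powR gt_eqF.
by rewrite mulrAC expRN divff ?mul1r// lt0r_neq0// expR_gt0.
Qed.

(** The first summand on the right is the Hardy integrand and takes care of [r] near 0; the constant
    1 takes care of the rest of the interval. The constant [K] does not depend on the function [u]
    that provides [y]. *)
Lemma integrand_bound :
  {within `[0, 1[%classic, continuous phi} ->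
  (exists c sigma : R, [/\ 0 < c, 1 < sigma &
     \forall r \near 0^'+, phi r * `|ln r| `^ sigma * ln `|ln r| <= c]) ->
  phi r / `|ln (1 - r)| @[r --> 1^'-] --> (0 : R) ->
  exists2 K, 0 <= K & forall r y, 0 < r -> r < 1 -> 0 <= y ->
    y <= C * r `^ (- ((alpha - p + 1) / p)) ->
    y <= ((1 - r) `^ (p - 1) * r `^ (- alpha)) `^ p^-1 ->
    r `^ theta * y `^ crit_exp p alpha theta * `|ln (tau + y)| `^ phi r <=
    K * (r `^ (alpha - p) * y `^ p + 1).
Proof.
move=> phi_cont phi_near0 phi_near1.
have [d [K0 [d0 d1 K00 near0]]] := logfactor_bounded_near0 phi_near0.
have [K1 K10 away0] := integrand_le_away0 d0 d1 phi_cont phi_near1.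
have K00' : 0 <= K0 * C `^ (q - p) by rewrite mulr_ge0 ?powR_ge0.
exists (K0 * C `^ (q - p) + K1) => [|r y r0 r1 y0 yC yend].
  by rewrite addr_ge0.
have z0 : 0 <= r `^ (alpha - p) * y `^ p by rewrite mulr_ge0 ?powR_ge0.
have [rd|dr] := ltP r d.
  apply: le_trans (integrand_le_near0 r0 y0 yC (near0 _ _ r0 rd y0 yC)) _.
  by apply: ler_pM => //; rewrite ?lerDl ?lerDr.
apply: le_trans (away0 r y dr r1 y0 yC yend) _.
by rewrite -[leLHS]mulr1; apply: ler_pM => //; rewrite ?lerDl ?lerDr.
Qed.

End PointwiseBound.

(** * Integration of the pointwise bound over the unit sphere of the gradient norm *)

Unset Implicit Arguments.

Theorem theorem1p1 (R : realType) (p alpha0 alpha1 theta : R)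
  (hp : 1 < p) (halpha0 : 0 <= alpha0) (halpha1 : 0 <= alpha1)
  (htheta : 0 <= theta)
  (hsob : 0 < alpha1 - p + 1) (h0 : alpha1 - p <= alpha0)
  (ht : alpha1 - p < theta)
  (phi : R -> R)
  (phi_cont : {within `[0%R, 1%R[%classic, continuous phi})
  (phi0 : phi 0 = 0)
  (phi_gt0 : forall r : R, 0 < r -> r < 1 -> 0 < phi r)
  (phi_near0 : exists c sigma : R, [/\ 0 < c, 1 < sigma &
     \forall r \near 0^'+,
       phi r * `|ln r| `^ sigma * ln `|ln r| <= c])
  (phi_near1 : phi r / `|ln (1 - r)| @[r --> 1^'-] --> (0 : R))
  (tau : R) (htau : 0 < tau) :
  (supS p alpha0 alpha1 theta tau phi < +oo)%E.
Proof.
have p0 : 0 < p by exact: lt_trans hp.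
have pN0 := lt0r_neq0 p0.
have pa : p - 1 < alpha1 by lra.
have a0 : 0 < (alpha1 - p + 1) / 2 by rewrite divr_gt0.
(* The radial constant: [weighted_tail_bound] with [m = alpha1] and unit energy, after a [p]-th
   root. *)
pose C := hardy_cst p alpha1 `^ p^-1.
have C0 : 0 <= C by exact: powR_ge0.
have [K K0 bound] := integrand_bound hp halpha1 htheta hsob ht htau C0 phi_gt0
  phi_cont phi_near0 phi_near1.
pose H := hardy_cst p ((alpha1 + p - 1) / 2) / ((alpha1 - p + 1) / 2).
have H0 : 0 <= H by rewrite divr_ge0 ?powR_ge0 ?ltW.
(* [H] bounds the Hardy integral of [u], and the summand 1 is the length of the interval. *)
apply: (@le_lt_trans _ _ (K * (H + 1))%:E); last exact: ltry.
apply: ge_ereal_sup => _ [u [uX u1] <-].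
have [[_ [mu_u _] [mu_u' _]] _] := uX.
have int1 : (\int[lebesgue_measure]_(r in `]0%R, 1%R[)
    (weighted_pow alpha1 p (derive1 u) r)%:E = 1)%E.
  by rewrite -(wLnorm_powE alpha1 (derive1 u) pN0) -/(grad_norm _ _ _) u1 poweR1r.
have radial := X1p_radial hp halpha0 halpha1 uX u1.
have uC r : 0 < r -> r < 1 -> `|u r| <= C * r `^ (- ((alpha1 - p + 1) / p)).
  move=> r0 r1; have [u'r _] := radial _ r0 r1.
  have sub : `]r, 1[%classic `<=` (`]0%R, 1%R[%classic : set R).
    by apply: set_interval.subset_itv; rewrite bnd_simp// ltW.
  have mr : measurable_fun `]r, 1[ (derive1 u) by exact: measurable_funS mu_u'.
  have := weighted_tail_bound hp pa r0 r1 mr u'r.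
  move=> /le_trans => /(_ (hardy_cst p alpha1 * r `^ (p - 1 - alpha1))%:E) ur.
  have -> : C * r `^ (- ((alpha1 - p + 1) / p)) =
      (hardy_cst p alpha1 * r `^ (p - 1 - alpha1)) `^ p^-1.
    rewrite powRM ?powR_ge0// -powRrM; congr (_ * _ `^ _).
    by rewrite -mulNr; congr (_ / _); ring.
  apply: le_powRV => //; rewrite -lee_fin; apply: ur.
  rewrite -[X in (_ <= X)%E]mule1; apply: lee_wpmul2l.
    by rewrite lee_fin mulr_ge0 ?powR_ge0.
  rewrite -int1; apply: ge0_subset_integral => //=.
  - by apply/measurable_EFinP; exact: measurable_weighted_pow.
  - by move=> x _; rewrite lee_fin weighted_pow_ge0.
have hardy : (\int[lebesgue_measure]_(r in `]0%R, 1%R[)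
    (weighted_pow (alpha1 - p) p u r)%:E <= H%:E)%E.
  have := hardy_inequality hp pa mu_u' mu_u (fun r r0 r1 => (radial r r0 r1).1).
  by rewrite int1 mule1.
apply: (@le_trans _ _ (\int[lebesgue_measure]_(r in `]0%R, 1%R[)
    (K%:E * ((weighted_pow (alpha1 - p) p u r)%:E + 1)))%E).
  (* The original integrand is not shown to be measurable; monotonicity of the lower integral
     suffices. *)
  apply: ge0_le_integral_nonmeasurable => r /=.
    by move=> _; rewrite lee_fin !mulr_ge0 ?powR_ge0.
  rewrite in_itv/= => /andP[r0 r1]; rewrite -EFinD -EFinM lee_fin.
  by apply: bound => //; [exact: uC|have [] := radial r r0 r1].
have mw : measurable_fun (`]0%R, 1%R[ : set R)
    (fun r => (weighted_pow (alpha1 - p) p u r)%:E).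
  by apply/measurable_EFinP; exact: measurable_weighted_pow.
have w0 r : (0 <= (weighted_pow (alpha1 - p) p u r)%:E)%E.
  by rewrite lee_fin weighted_pow_ge0.
rewrite ge0_integralZl//; last 2 first.
- exact: emeasurable_funD.
- by move=> r _; rewrite adde_ge0.
rewrite EFinM; apply: lee_wpmul2l; first by rewrite lee_fin.
rewrite ge0_integralD// EFinD; apply: leeD => //.
rewrite integral_cst//= mul1e lebesgue_measure_itv/= lte_fin ltr01.
by rewrite oppr0 adde0.
Qed.
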